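(* Let $K$ be a field and let $H$ be a Hopf algebra over $K$ with an $ad$-invariant integral $\lambda\in H^{*}$. Let $\mathcal{M}$ be either $\mathfrak{M}^{H}$ or ${}^{H}\mathfrak{M}^{H}$. Let $A$ and $E$ be algebras in $\mathcal{M}$ and let $\pi:E\to A$ be a surjective algebra homomorphism in $\mathcal{M}$. Assume that $A$ is formally smooth as an algebra in $\mathfrak{M}_{K}$ and that the kernel of $\pi$ is a nilpotent ideal. Then $\pi$ has a section which is an algebra homomorphism in $\mathcal{M}$.
   Context: Notation: $\Delta(h)=h_1\otimes h_2$ (Sweedler), $\varepsilon$ the counit, $S$ the antipode of $H$. $ad$-invariant integral: $\lambda\in H^{*}$ such that (a) $h_1\lambda(h_2)=1_H\lambda(h)$ for all $h\in H$; (b) $\lambda(h_1xS(h_2))=\varepsilon(h)\lambda(x)$ for all $h,x\in H$; (c) $\lambda(1_H)=1_K$. $\mathfrak{M}^H$ (resp. ${}^H\mathfrak{M}^H$) is the monoidal category of right $H$-comodules (resp. $H$-bicomodules), with $\otimes_K$ carrying codiagonal coaction(s) and unit $K$; $\mathfrak{M}_K$ is the category of $K$-vector spaces. An algebra homomorphism in $\mathcal{M}$ is an algebra homomorphism that is a morphism of $\mathcal{M}$. A $K$-algebra $A$ with multiplication $m:A\otimes_K A\to A$ is formally smooth as an algebra in $\mathfrak{M}_K$ if the $A$-bimodule $\Omega^1A=\ker m$ is projective relative to those $A$-bimodule morphisms that split as $K$-linear maps (since $K$ is a field, equivalently it is a projective $A$-bimodule). *)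

(* Defs.v *)
From HB Require Import structures.
From mathcomp Require Import all_boot all_algebra.
From mathcomp Require Import boolp.

Set Implicit Arguments.
Unset Strict Implicit.
Unset Printing Implicit Defensive.

Import GRing.Theory.
Local Open Scope ring_scope.
Local Open Scope quotient_scope.

(* The tensor product over K of two (possibly infinite-dimensional) vector    *)
(* spaces: finite formal sums of pairs modulo the congruence generated by     *)
(* commutativity, biadditivity and K-balancedness.                            *)

Inductive tens_eq (K : fieldType) (V W : lmodType K) :
    seq (V * W) -> seq (V * W) -> Prop :=
| tens_refl s : tens_eq s s
| tens_sym s t : tens_eq s t -> tens_eq t s
| tens_trans s t u : tens_eq s t -> tens_eq t u -> tens_eq s u
| tens_perm s t : perm_eq s t -> tens_eq s t
| tens_cat s s' t : tens_eq s s' -> tens_eq (s ++ t) (s' ++ t)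
| tens_zero w : tens_eq [:: (0, w)] [::]
| tens_addl v v' w : tens_eq [:: (v + v', w)] [:: (v, w); (v', w)]
| tens_addr v w w' : tens_eq [:: (v, w + w')] [:: (v, w); (v, w')]
| tens_bal (k : K) v w : tens_eq [:: (k *: v, w)] [:: (v, k *: w)].

Arguments tens_zero {K V W} w.

Section Tensor.
Variables (K : fieldType) (V W : lmodType K).
Implicit Types (s t : seq (V * W)).

Definition tens_eqb : rel (seq (V * W)) := fun s t => `[< tens_eq s t >].

Lemma tens_eqb_equiv : equiv_class_of tens_eqb.
Proof.
split=> [s|s t|t s u].
- exact/asboolP/tens_refl.
- by apply/asboolP/asboolP; apply: tens_sym.
- by move=> /asboolP st /asboolP tu; apply/asboolP/(tens_trans st tu).
Qed.

Canonical tens_equiv_rel := EquivRelPack tens_eqb_equiv.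

Definition tensor : Type := {eq_quot tens_eqb}.
HB.instance Definition _ := Choice.on tensor.
HB.instance Definition _ : EqQuotient _ tens_eqb tensor := EqQuotient.on tensor.

Definition tclass s : tensor := \pi_tensor s.

Definition pure v w : tensor := tclass [:: (v, w)].

Lemma tclassP s t : tclass s = tclass t <-> tens_eq s t.
Proof.
by split=> [/eqmodP/asboolP//|st]; apply/eqmodP/asboolP.
Qed.

Lemma tclassK (x : tensor) : tclass (repr x) = x.
Proof. exact: reprK. Qed.

Lemma repr_tclass s : tens_eq (repr (tclass s)) s.
Proof. by apply/tclassP; rewrite tclassK. Qed.

Lemma tens_catr s t t' : tens_eq t t' -> tens_eq (s ++ t) (s ++ t').
Proof.
move=> tt'; apply: (tens_trans (tens_perm _)); first by rewrite perm_catC.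
apply: (tens_trans (tens_cat s tt')); apply: tens_perm.
by rewrite perm_catC.
Qed.

Lemma tens_cat2 s s' t t' :
  tens_eq s s' -> tens_eq t t' -> tens_eq (s ++ t) (s' ++ t').
Proof. by move=> /(tens_cat t)/tens_trans; move=> + /(tens_catr s'); apply. Qed.

Definition scale_seq (k : K) s := [seq (k *: p.1, p.2) | p <- s].

Lemma tens_scale k s t : tens_eq s t -> tens_eq (scale_seq k s) (scale_seq k t).
Proof.
elim=> {s t} //=.
- by move=> s; exact: tens_refl.
- by move=> s t _; exact: tens_sym.
- by move=> s t u _ st _; exact: tens_trans.
- by move=> s t st; apply/tens_perm/perm_map.
- by move=> s s' t _ ss'; rewrite /scale_seq !map_cat; exact: tens_cat.
- by move=> w; rewrite scaler0; exact: tens_zero.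
- by move=> v v' w; rewrite scalerDr; exact: tens_addl.
- by move=> v w w'; exact: tens_addr.
- by move=> c v w; rewrite scalerA mulrC -scalerA; exact: tens_bal.
Qed.

Definition tadd (x y : tensor) := tclass (repr x ++ repr y).
Definition tscale (k : K) (x : tensor) := tclass (scale_seq k (repr x)).
Definition topp (x : tensor) := tscale (-1) x.

Lemma tadd_class s t : tadd (tclass s) (tclass t) = tclass (s ++ t).
Proof. by apply/tclassP/tens_cat2; exact: repr_tclass. Qed.

Lemma tscale_class k s : tscale k (tclass s) = tclass (scale_seq k s).
Proof. by apply/tclassP/tens_scale; exact: repr_tclass. Qed.

Lemma tensorW (P : tensor -> Prop) : (forall s, P (tclass s)) -> forall x, P x.
Proof. by move=> Ps x; rewrite -[x]tclassK. Qed.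

Lemma taddC : commutative tadd.
Proof.
elim/tensorW=> s; elim/tensorW=> t; rewrite !tadd_class.
by apply/tclassP/tens_perm; rewrite perm_catC.
Qed.

Lemma taddA : associative tadd.
Proof.
elim/tensorW=> s; elim/tensorW=> t; elim/tensorW=> u.
by rewrite !tadd_class catA.
Qed.

Lemma tadd0 : left_id (tclass [::]) tadd.
Proof. by elim/tensorW=> s; rewrite tadd_class. Qed.

Lemma tscale_split k l s :
  tens_eq (scale_seq (k + l) s) (scale_seq k s ++ scale_seq l s).
Proof.
elim: s => [|[v w] s IHs] /=; first exact: tens_refl.
rewrite scalerDl -cat1s.
apply: (tens_trans (tens_cat2 (tens_addl _ _ _) IHs)).
apply: tens_perm; rewrite /= perm_cons.
by rewrite -[(l *: v, w) :: _]cat1s -[(l *: v, w) :: _]cat1s perm_catCA.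
Qed.

Lemma tscale0_seq s : tens_eq (scale_seq 0 s) [::].
Proof.
elim: s => [|[v w] s IHs] /=; first exact: tens_refl.
by rewrite scale0r -cat1s; exact: (tens_cat2 (tens_zero w) IHs).
Qed.

Lemma scale1_seq s : scale_seq 1 s = s.
Proof. by elim: s => [|[v w] s IHs] //=; rewrite scale1r IHs. Qed.

Lemma taddN : left_inverse (tclass [::]) topp tadd.
Proof.
elim/tensorW=> s; rewrite /topp tscale_class tadd_class.
apply/tclassP; rewrite -{2}[s]scale1_seq.
apply: (tens_trans (tens_sym (tscale_split _ _ _))).
by rewrite addNr; exact: tscale0_seq.
Qed.

HB.instance Definition _ := GRing.isZmodule.Build tensor taddA taddC tadd0 taddN.

Lemma tscaleA k l x : tscale k (tscale l x) = tscale (k * l) x.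
Proof.
elim/tensorW: x => s; rewrite !tscale_class /scale_seq -map_comp.
by congr tclass; apply: eq_map => p /=; rewrite scalerA.
Qed.

Lemma tscale1 : left_id 1 tscale.
Proof. by elim/tensorW=> s; rewrite tscale_class scale1_seq. Qed.

Lemma tscaleDr : right_distributive tscale +%R.
Proof.
move=> k; elim/tensorW=> s; elim/tensorW=> t.
rewrite [_ + _]tadd_class !tscale_class [RHS]tadd_class.
by rewrite /scale_seq map_cat.
Qed.

Lemma tscaleDl x : {morph tscale^~ x : k l / k + l}.
Proof.
move=> k l; elim/tensorW: x => s; rewrite !tscale_class [RHS]tadd_class.
exact/tclassP/tscale_split.
Qed.

HB.instance Definition _ :=
  GRing.Zmodule_isLmodule.Build K tensor tscaleA tscale1 tscaleDr tscaleDl.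

End Tensor.

Notation "V \ox W" := (tensor V W)
  (at level 40, left associativity) : type_scope.
Notation "v *t w" := (pure v w)
  (at level 40, left associativity) : ring_scope.

(* Sweedler-style sums: \tsum_(v *t w <- x) F v w is the image of x under the *)
(* linear map V \ox W -> U induced by the bilinear map F.  It is computed on  *)
(* a chosen representative of x, so it is meaningful only for bilinear F (see *)
(* tlift_pure and tlift_linear); every use below is of that kind.             *)
Definition tlift (K : fieldType) (V W : lmodType K) (U : nmodType)
    (x : V \ox W) (F : V -> W -> U) : U :=
  \sum_(p <- repr x) F p.1 p.2.

Notation "\tsum_ ( v *t w <- x ) F" := (tlift x (fun v w => F))
  (at level 41, v name, w name, x at level 200, F at level 41,
   format "'[' \tsum_ ( v  *t  w  <-  x ) '/  '  F ']'") : ring_scope.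

Definition bilin (K : fieldType) (V W U : lmodType K) (F : V -> W -> U) :=
  (forall w, linear (F^~ w)) /\ (forall v, linear (F v)).

Section TensorTheory.
Variables (K : fieldType) (V W : lmodType K).

Lemma pureDl (v v' : V) (w : W) : (v + v') *t w = v *t w + v' *t w.
Proof. by rewrite [RHS]tadd_class; exact/tclassP/tens_addl. Qed.

Lemma pureDr (v : V) (w w' : W) : v *t (w + w') = v *t w + v *t w'.
Proof. by rewrite [RHS]tadd_class; exact/tclassP/tens_addr. Qed.

Lemma pureZl k (v : V) (w : W) : (k *: v) *t w = k *: (v *t w).
Proof. by rewrite [RHS]tscale_class. Qed.

Lemma pureZr k (v : V) (w : W) : v *t (k *: w) = k *: (v *t w).
Proof. by rewrite -pureZl; apply/tclassP/tens_sym/tens_bal. Qed.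

Lemma pure_bilin : bilin (@pure K V W).
Proof.
by split=> [w|v] k x y; rewrite ?pureDl ?pureZl ?pureDr ?pureZr.
Qed.

Lemma tclass_sum s : tclass s = \sum_(p <- s) p.1 *t p.2 :> V \ox W.
Proof.
elim: s => [|[v w] s IHs]; first by rewrite big_nil.
by rewrite big_cons -IHs [RHS]tadd_class.
Qed.

Lemma tensor_ind (P : V \ox W -> Prop) :
  P 0 -> (forall v w x, P x -> P (v *t w + x)) -> forall x, P x.
Proof.
move=> P0 PS; elim/tensorW=> s; rewrite tclass_sum.
by elim: s => [|p s IHs]; rewrite ?big_nil // big_cons; apply: PS.
Qed.

Section Lift.
Variables (U : lmodType K) (F : V -> W -> U).
Hypothesis bF : bilin F.

Lemma tlift_eq s t :
  tens_eq s t -> \sum_(p <- s) F p.1 p.2 = \sum_(p <- t) F p.1 p.2.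
Proof.
have FDl v v' w : F (v + v') w = F v w + F v' w.
  by have := bF.1 w 1 v v'; rewrite !scale1r.
have FDr v w w' : F v (w + w') = F v w + F v w'.
  by have := bF.2 v 1 w w'; rewrite !scale1r.
have F0l w : F 0 w = 0.
  by apply: (addrI (F 0 w)); rewrite -FDl !addr0.
have F0r v : F v 0 = 0.
  by apply: (addrI (F v 0)); rewrite -FDr !addr0.
have FZl k v w : F (k *: v) w = k *: F v w.
  by have := bF.1 w k v 0; rewrite F0l !addr0.
have FZr k v w : F v (k *: w) = k *: F v w.
  by have := bF.2 v k w 0; rewrite F0r !addr0.
elim=> {s t} //=.
- by move=> s t u _ -> _ ->.
- by move=> s t st; apply: perm_big.
- by move=> s s' t _ ss'; rewrite !big_cat ss'.
- by move=> w; rewrite big_seq1 big_nil.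
- by move=> v v' w; rewrite !big_cons !big_nil /= FDl !addr0.
- by move=> v w w'; rewrite !big_cons !big_nil /= FDr !addr0.
- by move=> k v w; rewrite !big_seq1 /= FZl FZr.
Qed.

Lemma tlift_class s : tlift (tclass s) F = \sum_(p <- s) F p.1 p.2.
Proof. exact/tlift_eq/repr_tclass. Qed.

Lemma tlift_pure v w : \tsum_(a *t b <- v *t w) F a b = F v w.
Proof. by rewrite /pure tlift_class big_seq1. Qed.

Lemma tlift_linear : linear (fun x => tlift x F).
Proof.
move=> k; elim/tensorW=> s; elim/tensorW=> t.
rewrite [_ *: _]tscale_class [_ + _]tadd_class !tlift_class big_cat /=.
congr (_ + _); rewrite scaler_sumr big_map; apply: eq_bigr => p _ /=.
have F0 : F 0 p.2 = 0.
  by have := bF.1 p.2 (-1) 0 0; rewrite scaler0 addr0 scaleN1r addNr.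
by have := bF.1 p.2 k p.1 0; rewrite addr0 F0 addr0.
Qed.

Lemma tlift_unique (g : {linear V \ox W -> U}) :
  (forall v w, g (v *t w) = F v w) -> forall x, g x = tlift x F.
Proof.
move=> gF; elim/tensorW=> s; rewrite tlift_class tclass_sum linear_sum.
by apply: eq_bigr => p _; rewrite gF.
Qed.

End Lift.
End TensorTheory.

(* Associative unital K-algebras.  The library's algType requires 1 != 0;     *)
(* here the zero algebra is allowed.                                          *)
Record kalg (K : fieldType) := KAlg {
  kalg_mod : lmodType K;
  kalg_mul : kalg_mod -> kalg_mod -> kalg_mod;
  kalg_one : kalg_mod;
  kalg_mulA : associative kalg_mul;
  kalg_mul1l : left_id kalg_one kalg_mul;
  kalg_mul1r : right_id kalg_one kalg_mul;
  kalg_mulDl : left_distributive kalg_mul +%R;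
  kalg_mulDr : right_distributive kalg_mul +%R;
  kalg_mulZl : forall k x y, kalg_mul (k *: x) y = k *: kalg_mul x y;
  kalg_mulZr : forall k x y, kalg_mul x (k *: y) = k *: kalg_mul x y
}.

Definition kalg_sort (K : fieldType) (A : kalg K) : Type := kalg_mod A.
Coercion kalg_sort : kalg >-> Sortclass.

Section KAlgInstances.
Variables (K : fieldType) (A : kalg K).
HB.instance Definition _ := GRing.Lmodule.on (kalg_sort A).
HB.instance Definition _ := GRing.Zmodule_isPzRing.Build (kalg_sort A)
  (@kalg_mulA K A) (@kalg_mul1l K A) (@kalg_mul1r K A)
  (@kalg_mulDl K A) (@kalg_mulDr K A).

Lemma kscalerAl k (x y : A) : k *: (x * y) = (k *: x) * y.
Proof. by rewrite [RHS]kalg_mulZl. Qed.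

Lemma kscalerAr k (x y : A) : k *: (x * y) = x * (k *: y).
Proof. by rewrite [RHS]kalg_mulZr. Qed.
End KAlgInstances.

Definition kalg_lmod (K : fieldType) (A : kalg K) : lmodType K := kalg_sort A.
Coercion kalg_lmod : kalg >-> GRing.Lmodule.type.

Definition mul_tensor (K : fieldType) (A : kalg K) (x : A \ox A) : A :=
  \tsum_(a *t b <- x) (a * b).

Definition nilpotent_ideal (K : fieldType) (E : kalg K) (I : E -> Prop) :=
  exists n, forall x : 'I_n -> E, (forall i, I (x i)) -> \prod_(i < n) x i = 0.

(* Hopf algebras.  In hopf_coassoc, (H \ox H) \ox H is identified with        *)
(* H \ox (H \ox H).                                                           *)
Record hopf (K : fieldType) := Hopf {
  hopf_kalg :> kalg K;
  Delta : {linear hopf_kalg -> hopf_kalg \ox hopf_kalg};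
  counit : {scalar hopf_kalg};
  antipode : {linear hopf_kalg -> hopf_kalg};
  hopf_coassoc : forall h,
    \tsum_(a *t b <- Delta h) \tsum_(a1 *t a2 <- Delta a) (a1 *t (a2 *t b)) =
    \tsum_(a *t b <- Delta h) \tsum_(b1 *t b2 <- Delta b) (a *t (b1 *t b2));
  hopf_counitl : forall h, \tsum_(a *t b <- Delta h) (counit a *: b) = h;
  hopf_counitr : forall h, \tsum_(a *t b <- Delta h) (counit b *: a) = h;
  hopf_DeltaM : forall g h : hopf_kalg, Delta (g * h) =
    \tsum_(a *t b <- Delta g) \tsum_(c *t d <- Delta h) ((a * c) *t (b * d));
  hopf_Delta1 : Delta 1 = (1 : hopf_kalg) *t (1 : hopf_kalg);
  hopf_counitM : forall g h : hopf_kalg, counit (g * h) = counit g * counit h;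
  hopf_counit1 : counit 1 = 1;
  hopf_antipodel : forall h,
    \tsum_(a *t b <- Delta h) (antipode a * b) = counit h *: (1 : hopf_kalg);
  hopf_antipoder : forall h,
    \tsum_(a *t b <- Delta h) (a * antipode b) = counit h *: (1 : hopf_kalg)
}.

Arguments Delta {K} H : rename.
Arguments counit {K} H : rename.
Arguments antipode {K} H : rename.

Record ad_invariant_integral (K : fieldType) (H : hopf K) (lam : {scalar H})
    : Prop := AdInvariantIntegral {
  adint_integral : forall h : H,
    \tsum_(h1 *t h2 <- Delta H h) (lam h2 *: h1) = lam h *: (1 : H);
  adint_ad : forall h x : H,
    \tsum_(h1 *t h2 <- Delta H h) lam (h1 * x * antipode H h2) =
    counit H h * lam x;
  adint_one : lam 1 = 1
}.

Section Comodules.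
Variables (K : fieldType) (H : hopf K).
Implicit Types V W : lmodType K.

Definition is_rcomodule V (rho : {linear V -> V \ox H}) : Prop :=
  (forall v,
    \tsum_(v0 *t h <- rho v) \tsum_(v00 *t v01 <- rho v0) (v00 *t (v01 *t h)) =
    \tsum_(v0 *t h <- rho v) \tsum_(h1 *t h2 <- Delta H h) (v0 *t (h1 *t h2)))
  /\ (forall v, \tsum_(v0 *t h <- rho v) (counit H h *: v0) = v).

Definition is_lcomodule V (rho : {linear V -> H \ox V}) : Prop :=
  (forall v,
    \tsum_(h *t v0 <- rho v) \tsum_(v01 *t v00 <- rho v0) (h *t (v01 *t v00)) =
    \tsum_(h *t v0 <- rho v) \tsum_(h1 *t h2 <- Delta H h) (h1 *t (h2 *t v0)))
  /\ (forall v, \tsum_(h *t v0 <- rho v) (counit H h *: v0) = v).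

Definition is_bicomodule V
    (rhol : {linear V -> H \ox V}) (rhor : {linear V -> V \ox H}) : Prop :=
  [/\ is_lcomodule rhol, is_rcomodule rhor &
    forall v,
      \tsum_(h *t v0 <- rhol v) \tsum_(v00 *t g <- rhor v0)
        (h *t (v00 *t g)) =
      \tsum_(v0 *t g <- rhor v) \tsum_(h *t v00 <- rhol v0)
        (h *t (v00 *t g))].

Definition rcolinear V W (rhoV : V -> V \ox H) (rhoW : W -> W \ox H)
    (f : V -> W) : Prop :=
  forall v, rhoW (f v) = \tsum_(v0 *t h <- rhoV v) (f v0 *t h).

Definition lcolinear V W (rhoV : V -> H \ox V) (rhoW : W -> H \ox W)
    (f : V -> W) : Prop :=
  forall v, rhoW (f v) = \tsum_(h *t v0 <- rhoV v) (h *t f v0).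

Definition rcodiag V W (rhoV : V -> V \ox H) (rhoW : W -> W \ox H)
    (x : V \ox W) : (V \ox W) \ox H :=
  \tsum_(v *t w <- x) \tsum_(v0 *t g <- rhoV v) \tsum_(w0 *t h <- rhoW w)
    ((v0 *t w0) *t (g * h)).

Definition lcodiag V W (rhoV : V -> H \ox V) (rhoW : W -> H \ox W)
    (x : V \ox W) : H \ox (V \ox W) :=
  \tsum_(v *t w <- x) \tsum_(g *t v0 <- rhoV v) \tsum_(h *t w0 <- rhoW w)
    ((g * h) *t (v0 *t w0)).

Definition rtriv (k : K^o) : K^o \ox H := k *t (1 : H).
Definition ltriv (k : K^o) : H \ox K^o := (1 : H) *t k.

End Comodules.

Definition unit_map (K : fieldType) (A : kalg K) (k : K^o) : A := k *: (1 : A).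

(* Algebras in the category of right H-comodules. *)
Record rcomod_alg (K : fieldType) (H : hopf K) := RComodAlg {
  rca_kalg :> kalg K;
  rca_coact : {linear rca_kalg -> rca_kalg \ox H};
  rca_comodule : is_rcomodule rca_coact;
  rca_mul : rcolinear (rcodiag rca_coact rca_coact) rca_coact
              (@mul_tensor K rca_kalg);
  rca_unit : rcolinear (@rtriv K H) rca_coact (@unit_map K rca_kalg)
}.

(* Algebras in the category of H-bicomodules. *)
Record bicomod_alg (K : fieldType) (H : hopf K) := BicomodAlg {
  bca_kalg :> kalg K;
  bca_lcoact : {linear bca_kalg -> H \ox bca_kalg};
  bca_rcoact : {linear bca_kalg -> bca_kalg \ox H};
  bca_bicomodule : is_bicomodule bca_lcoact bca_rcoact;
  bca_lmul : lcolinear (lcodiag bca_lcoact bca_lcoact) bca_lcoact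
               (@mul_tensor K bca_kalg);
  bca_rmul : rcolinear (rcodiag bca_rcoact bca_rcoact) bca_rcoact
               (@mul_tensor K bca_kalg);
  bca_lunit : lcolinear (@ltriv K H) bca_lcoact (@unit_map K bca_kalg);
  bca_runit : rcolinear (@rtriv K H) bca_rcoact (@unit_map K bca_kalg)
}.

Definition rcomod_alg_hom (K : fieldType) (H : hopf K) (A B : rcomod_alg H)
    (f : {linear A -> B}) : Prop :=
  GRing.monoid_morphism f /\ rcolinear (rca_coact A) (rca_coact B) f.

Definition bicomod_alg_hom (K : fieldType) (H : hopf K) (A B : bicomod_alg H)
    (f : {linear A -> B}) : Prop :=
  [/\ GRing.monoid_morphism f,
      lcolinear (bca_lcoact A) (bca_lcoact B) f &
      rcolinear (bca_rcoact A) (bca_rcoact B) f].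

(* A-bimodules on which K acts centrally. *)
Record bimod (K : fieldType) (A : kalg K) := Bimod {
  bimod_mod :> lmodType K;
  lact : A -> bimod_mod -> bimod_mod;
  ract : bimod_mod -> A -> bimod_mod;
  lact_bilin : bilin lact;
  ract_bilin : bilin ract;
  lactA : forall a b x, lact a (lact b x) = lact (a * b) x;
  ractA : forall x a b, ract (ract x a) b = ract x (a * b);
  lact1 : forall x, lact 1 x = x;
  ract1 : forall x, ract x 1 = x;
  lractA : forall a x b, ract (lact a x) b = lact a (ract x b)
}.

Definition bimod_hom (K : fieldType) (A : kalg K) (M N : bimod A)
    (f : {linear M -> N}) : Prop :=
  (forall a x, f (lact a x) = lact a (f x)) /\
  (forall x a, f (ract x a) = ract (f x) a).

Section Omega.
Variables (K : fieldType) (A : kalg K).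

Lemma mul_bilin : bilin (fun a b : A => a * b).
Proof.
split=> [b|a] k x y; first by rewrite mulrDl kscalerAl.
by rewrite mulrDr kscalerAr.
Qed.

Lemma mul_tensor_linear : linear (@mul_tensor K A).
Proof. exact/tlift_linear/mul_bilin. Qed.
HB.instance Definition _ :=
  GRing.isLinear.Build K (A \ox A) A *:%R (@mul_tensor K A) mul_tensor_linear.

Lemma mul_tensor_pure (a b : A) : mul_tensor (a *t b) = a * b.
Proof. exact: (tlift_pure mul_bilin). Qed.

Lemma mul_tensorD x y :
  mul_tensor (x + y) = mul_tensor x + mul_tensor y :> A.
Proof. exact: linearD. Qed.

Lemma mul_tensor0 : mul_tensor 0 = 0 :> A.
Proof. exact: linear0. Qed.

Definition tlact (a : A) (x : A \ox A) : A \ox A :=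
  \tsum_(b *t c <- x) ((a * b) *t c).
Definition tract (x : A \ox A) (a : A) : A \ox A :=
  \tsum_(b *t c <- x) (b *t (c * a)).

Lemma tlact_bilin0 a : bilin (fun b c : A => (a * b) *t c).
Proof.
split=> [c|b] k x y.
  by rewrite mulrDr -kscalerAr pureDl pureZl.
by rewrite pureDr pureZr.
Qed.

Lemma tract_bilin0 a : bilin (fun b c : A => b *t (c * a)).
Proof.
split=> [c|b] k x y; first by rewrite pureDl pureZl.
by rewrite mulrDl -kscalerAl pureDr pureZr.
Qed.

HB.instance Definition _ a := GRing.isLinear.Build K (A \ox A) (A \ox A) *:%R
  (tlact a) (tlift_linear (tlact_bilin0 a)).

Lemma tract_linear a : linear (tract^~ a).
Proof. exact/tlift_linear/tract_bilin0. Qed.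

Lemma tlact_pure a b c : tlact a (b *t c) = (a * b) *t c.
Proof. exact: (tlift_pure (tlact_bilin0 a)). Qed.

Lemma tract_pure a b c : tract (b *t c) a = b *t (c * a).
Proof. exact: (tlift_pure (tract_bilin0 a)). Qed.

Lemma tlact0 a : tlact a 0 = 0.
Proof. exact: linear0. Qed.

Lemma tlactD a x y : tlact a (x + y) = tlact a x + tlact a y.
Proof. exact: linearD. Qed.

Lemma tractD x y a : tract (x + y) a = tract x a + tract y a.
Proof. by have := tract_linear a 1 x y; rewrite !scale1r. Qed.

Lemma tract0 a : tract 0 a = 0.
Proof. by apply: (addrI (tract 0 a)); rewrite -tractD !addr0. Qed.

Lemma tlactP : bilin tlact.
Proof.
split=> [x|a] k; last exact: linearP.
move=> a b; elim/tensor_ind: x => [|v w x IHx].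
  by rewrite !linear0 addr0.
rewrite !tlactD IHx !tlact_pure mulrDl -kscalerAl pureDl pureZl.
by rewrite addrACA -scalerDr.
Qed.

Lemma tractP : bilin tract.
Proof.
split=> [a|x] k; first exact: tract_linear.
move=> a b; elim/tensor_ind: x => [|v w x IHx].
  by rewrite !tract0 scaler0 addr0.
rewrite !tractD IHx !tract_pure mulrDr -kscalerAr pureDr pureZr.
by rewrite addrACA -scalerDr.
Qed.

Lemma tlactA a b x : tlact a (tlact b x) = tlact (a * b) x.
Proof.
elim/tensor_ind: x => [|v w x IHx]; first by rewrite !linear0.
by rewrite !tlactD IHx !tlact_pure mulrA.
Qed.

Lemma tractA x a b : tract (tract x a) b = tract x (a * b).
Proof.
elim/tensor_ind: x => [|v w x IHx]; first by rewrite !tract0.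
by rewrite !tractD IHx !tract_pure mulrA.
Qed.

Lemma tlact1 x : tlact 1 x = x.
Proof.
elim/tensor_ind: x => [|v w x IHx]; first by rewrite linear0.
by rewrite tlactD IHx tlact_pure mul1r.
Qed.

Lemma tract1 x : tract x 1 = x.
Proof.
elim/tensor_ind: x => [|v w x IHx]; first by rewrite tract0.
by rewrite tractD IHx tract_pure mulr1.
Qed.

Lemma tlractA a x b : tract (tlact a x) b = tlact a (tract x b).
Proof.
elim/tensor_ind: x => [|v w x IHx]; first by rewrite tract0 !linear0 tract0.
by rewrite !(tlactD, tractD) IHx !(tlact_pure, tract_pure).
Qed.

Lemma mul_tlact a x : mul_tensor (tlact a x) = a * mul_tensor x.
Proof.
elim/tensor_ind: x => [|v w x IHx]; first by rewrite tlact0 mul_tensor0 mulr0.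
by rewrite tlactD !mul_tensorD IHx tlact_pure !mul_tensor_pure mulrDr mulrA.
Qed.

Lemma mul_tract x a : mul_tensor (tract x a) = mul_tensor x * a.
Proof.
elim/tensor_ind: x => [|v w x IHx]; first by rewrite tract0 mul_tensor0 mul0r.
by rewrite tractD !mul_tensorD IHx tract_pure !mul_tensor_pure mulrDl mulrA.
Qed.

Definition ker_mul : {pred A \ox A} := fun x => mul_tensor x == 0.

Lemma ker_mul_closed : submod_closed ker_mul.
Proof.
split=> [|k x y]; rewrite !unfold_in ?mul_tensor0 // => /eqP xM /eqP yM.
apply/eqP; rewrite mul_tensor_linear [mul_tensor x]xM [mul_tensor y]yM.
by rewrite scaler0 addr0.
Qed.
HB.instance Definition _ :=
  GRing.isSubmodClosed.Build K (A \ox A) ker_mul ker_mul_closed.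

Record omega1 := Omega1 { omega1_val :> A \ox A; _ : omega1_val \in ker_mul }.
HB.instance Definition _ := [isSub for omega1_val].
HB.instance Definition _ := [Choice of omega1 by <:].
HB.instance Definition _ := [SubChoice_isSubLmodule of omega1 by <:].

Lemma omega1_lact_subproof a (x : omega1) : tlact a (val x) \in ker_mul.
Proof.
by case: x => x /= xP; rewrite unfold_in mul_tlact (eqP xP) mulr0.
Qed.

Lemma omega1_ract_subproof (x : omega1) a : tract (val x) a \in ker_mul.
Proof.
by case: x => x /= xP; rewrite unfold_in mul_tract (eqP xP) mul0r.
Qed.

Definition omega1_lact a (x : omega1) := Omega1 (omega1_lact_subproof a x).
Definition omega1_ract (x : omega1) a := Omega1 (omega1_ract_subproof x a).

Lemma omega1_lact_bilin : bilin omega1_lact.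
Proof.
by split=> [x|a] k y z; apply: val_inj; [apply: tlactP.1 | apply: tlactP.2].
Qed.

Lemma omega1_ract_bilin : bilin omega1_ract.
Proof.
by split=> [x|a] k y z; apply: val_inj; [apply: tractP.1 | apply: tractP.2].
Qed.

Definition omega1_bimod : bimod A.
Proof.
apply: (@Bimod K A omega1 omega1_lact omega1_ract
          omega1_lact_bilin omega1_ract_bilin).
- by move=> a b x; apply: val_inj; exact: tlactA.
- by move=> x a b; apply: val_inj; exact: tractA.
- by move=> x; apply: val_inj; exact: tlact1.
- by move=> x; apply: val_inj; exact: tract1.
- by move=> a x b; apply: val_inj; exact: tlractA.
Defined.

End Omega.

Definition formally_smooth (K : fieldType) (A : kalg K) : Prop :=
  forall (M N : bimod A) (g : {linear M -> N}),
    bimod_hom g -> (exists s : {linear N -> M}, cancel s g) ->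
  forall f : {linear omega1_bimod A -> N}, bimod_hom f ->
  exists2 h : {linear omega1_bimod A -> M}, bimod_hom h & g \o h =1 f.

(* Main.v *)
(* Averaging against the integral turns a K-linear map f : A -> E into the
   right colinear map a |-> \sum lam(f(a_0)_1 S(a_1)) f(a_0)_0.  Ad-invariance
   makes this operator commute with left and right multiplication by colinear
   maps.  Since lam(1) = 1 forces lam = lam o S, the integral is two-sided, and
   \sum lam(S(a_-1) f(a_0)_-1) f(a_0)_0 does the same for left coactions.

   Start from a unital linear section s of pi, averaged on both sides.  Formal
   smoothness of A yields a derivation T : A -> A (x) A (x) A which lifts the
   universal derivation a |-> 1 (x) a - a (x) 1.  Let
   c(a, b) = s(a) s(b) - s(ab) take values in ker(pi)^n with n >= 1, and put
   u(a) = \sum c(x, y) s(z), where T(a) = \sum x (x) y (x) z.  The cocycle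
   identity for c shows that c is the coboundary of u modulo ker(pi)^(n+1), and
   averaging u preserves this.  Hence s plus the average of u is multiplicative
   modulo ker(pi)^(n+1), and after finitely many steps it is multiplicative.
   No quotient of E is needed.

   A right comodule is a bicomodule with the trivial left coaction v |-> 1 (x) v. *)

Require Import Defs.
From HB Require Import structures.
From mathcomp Require Import all_boot all_algebra.
From mathcomp Require Import boolp classical_sets.
Import GRing.Theory.
Local Open Scope ring_scope.

Set Implicit Arguments.
Unset Strict Implicit.
Unset Printing Implicit Defensive.

(** * Multilinear calculus on tensor products *)

Section TensorSums.
Variable K : fieldType.
Implicit Types U V W X : lmodType K.

Lemma eq_tlift V W (U : nmodType) (x : V \ox W) (F G : V -> W -> U) :
  (forall v w, F v w = G v w) -> tlift x F = tlift x G.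
Proof. by move=> FG; apply: eq_bigr => p _; apply: FG. Qed.

Lemma linear_tlift V W U U' (g : U -> U') (x : V \ox W) (F : V -> W -> U) :
  linear g -> g (tlift x F) = tlift x (fun v w => g (F v w)).
Proof.
move=> lg; pose gM := GRing.isLinear.Build K U U' *:%R g lg.
pose gL : {linear U -> U'} := HB.pack g gM.
by rewrite -[g]/(gL : U -> U') [LHS]linear_sum.
Qed.

Lemma exchange_tlift V W V' W' (U : nmodType) (x : V \ox W) (y : V' \ox W')
    (F : V -> W -> V' -> W' -> U) :
  tlift x (fun v w => tlift y (F v w)) =
  tlift y (fun v' w' => tlift x (fun v w => F v w v' w')).
Proof. exact: exchange_big. Qed.

Lemma tliftD V W U (x : V \ox W) (F G : V -> W -> U) :
  tlift x (fun v w => F v w + G v w) = tlift x F + tlift x G.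
Proof. exact: big_split. Qed.

Lemma tliftN V W U (x : V \ox W) (F : V -> W -> U) :
  tlift x (fun v w => - F v w) = - tlift x F.
Proof. exact: sumrN. Qed.

Lemma tliftB V W U (x : V \ox W) (F G : V -> W -> U) :
  tlift x (fun v w => F v w - G v w) = tlift x F - tlift x G.
Proof. by rewrite tliftD tliftN. Qed.

Lemma tliftZ V W U k (x : V \ox W) (F : V -> W -> U) :
  tlift x (fun v w => k *: F v w) = k *: tlift x F.
Proof. by rewrite [RHS]scaler_sumr. Qed.

Lemma tlift_tlift V W V' W' U (x : V \ox W) (G : V -> W -> V' \ox W')
    (F : V' -> W' -> U) : bilin F ->
  tlift (tlift x G) F = tlift x (fun v w => tlift (G v w) F).
Proof. by move=> bF; rewrite (linear_tlift _ _ (tlift_linear bF)). Qed.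

Lemma tlift_purew V W (x : V \ox W) : tlift x (@pure K V W) = x.
Proof. by rewrite -[RHS]tclassK tclass_sum. Qed.

Lemma tlift_pred V W (U : nmodType) (P : U -> Prop) (x : V \ox W)
    (F : V -> W -> U) :
  P 0 -> (forall a b, P a -> P b -> P (a + b)) -> (forall v w, P (F v w)) ->
  P (tlift x F).
Proof. by move=> P0 PD PF; apply: big_ind => // p _; apply: PF. Qed.

(** * Linearity rules for the term formers, dispatched by the tactic [lin] *)

Section Linearity.
Variables (X : lmodType K).

Lemma lin_id : linear (fun x : X => x). Proof. by []. Qed.

Lemma lin_app V W (f : {linear V -> W}) (G : X -> V) :
  linear G -> linear (fun x => f (G x)).
Proof. by move=> lG k x y; rewrite lG linearP. Qed.

Lemma lin_apps V (f : {scalar V}) (G : X -> V) :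
  linear G -> linear (fun x => f (G x) : K^o).
Proof. by move=> lG k x y; rewrite lG linearP. Qed.

Lemma lin_comp V W (f : V -> W) (G : X -> V) :
  linear f -> linear G -> linear (fun x => f (G x)).
Proof. by move=> lf lG k x y; rewrite lG lf. Qed.

Lemma lin_bilinl V W U (b : V -> W -> U) (G : X -> V) (w : W) :
  bilin b -> linear G -> linear (fun x => b (G x) w).
Proof. by case=> bl _; apply: (lin_comp (bl w)). Qed.

Lemma lin_bilinr V W U (b : V -> W -> U) (v : V) (G : X -> W) :
  bilin b -> linear G -> linear (fun x => b v (G x)).
Proof. by case=> _ br; apply: (lin_comp (br v)). Qed.

Lemma lin_add V (F G : X -> V) :
  linear F -> linear G -> linear (fun x => F x + G x).
Proof. by move=> lF lG k x y; rewrite lF lG scalerDr addrACA. Qed.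

Lemma lin_opp V (F : X -> V) : linear F -> linear (fun x => - F x).
Proof. by move=> lF k x y; rewrite lF scalerN opprD. Qed.

Lemma lin_tlift_arg V W U (G : X -> V \ox W) (F : V -> W -> U) :
  linear G -> bilin F -> linear (fun x => tlift (G x) F).
Proof. by move=> lG bF k x y; rewrite lG (tlift_linear bF). Qed.

Lemma lin_tlift_body V W U (t : V \ox W) (F : X -> V -> W -> U) :
  (forall v w, linear (fun x => F x v w)) -> linear (fun x => tlift t (F x)).
Proof.
move=> lF k x y; rewrite -tliftZ -tliftD; apply: eq_tlift => v w; exact: lF.
Qed.

Lemma lin_purel V W (G : X -> V) (w : W) :
  linear G -> linear (fun x => G x *t w).
Proof. by move=> lG k x y; rewrite lG pureDl pureZl. Qed.

Lemma lin_purer V W (v : V) (G : X -> W) :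
  linear G -> linear (fun x => v *t G x).
Proof. by move=> lG k x y; rewrite lG pureDr pureZr. Qed.

Lemma lin_mull (A : kalg K) (G : X -> A) (b : A) :
  linear G -> linear (fun x => G x * b).
Proof. by move=> lG k x y; rewrite lG mulrDl kscalerAl. Qed.

Lemma lin_mulr (A : kalg K) (G : X -> A) (b : A) :
  linear G -> linear (fun x => b * G x).
Proof. by move=> lG k x y; rewrite lG mulrDr kscalerAr. Qed.

Lemma lin_scalel V (G : X -> K^o) (v : V) :
  linear G -> linear (fun x => G x *: v).
Proof. by move=> lG k x y; rewrite lG scalerDl scalerA. Qed.

Lemma lin_scaler V (G : X -> V) (k : K) :
  linear G -> linear (fun x => k *: G x).
Proof. by move=> lG l x y; rewrite lG scalerDr !scalerA mulrC. Qed.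

End Linearity.
End TensorSums.

(** * The tensor product of two algebras *)

Section TensorMul.
Variables (K : fieldType).
Implicit Types (A B : kalg K) (V W X U : lmodType K).

(** The product of the tensor product algebra. With it, multiplicativity of a comultiplication or of
    a coaction becomes a single equation. *)
Definition tmul A B (x y : A \ox B) : A \ox B :=
  \tsum_(a *t b <- x) \tsum_(c *t d <- y) ((a * c) *t (b * d)).

Lemma lin_tmull V A B (G : V -> A \ox B) (y : A \ox B) :
  linear G -> linear (fun x => tmul (G x) y).
Proof.
move=> lG; apply: lin_tlift_arg => //; split=> [b|a]; cbv beta.
  by apply: lin_tlift_body => c d; apply: lin_purel; apply: lin_mull;
    apply: lin_id.
by apply: lin_tlift_body => c d; apply: lin_purer; apply: lin_mull;
  apply: lin_id.
Qed.

Lemma lin_tmulr V A B (x : A \ox B) (G : V -> A \ox B) :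
  linear G -> linear (fun y => tmul x (G y)).
Proof.
move=> lG; apply: lin_tlift_body => a b; apply: lin_tlift_arg => //.
by split=> [d|c]; [apply: lin_purel | apply: lin_purer];
  apply: lin_mulr; apply: lin_id.
Qed.

Definition trilin V W X U (F : V -> W -> X -> U) :=
  [/\ forall w x, linear (fun v => F v w x),
      forall v x, linear (fun w => F v w x) &
      forall v w, linear (fun x => F v w x)].

End TensorMul.

(* [lin] proves linearity, in each variable, of an expression in which that
   variable occurs exactly once. *)
Ltac lin :=
  lazymatch goal with
  | |- bilin _ => split; intro; cbv beta; lin
  | |- trilin _ => split; intros ? ?; cbv beta; lin
  | |- GRing.linear_for _ (fun x => x) => exact: lin_id
  | |- GRing.linear_for _ (fun x => tlift (@?G x) (@?F x)) =>
    lazymatch F with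
    | (fun _ => ?c) => apply: lin_tlift_arg; lin
    | _ => apply: lin_tlift_body; intros ? ?; cbv beta; lin
    end
  | |- GRing.linear_for _ (fun x => (@?F x) + (@?G x)) => apply: lin_add; lin
  | |- GRing.linear_for _ (fun x => - (@?F x)) => apply: lin_opp; lin
  | |- GRing.linear_for _ (fun x => pure (@?F x) (@?G x)) =>
    lazymatch F with
    | (fun _ => ?c) => apply: lin_purer; lin
    | _ => apply: lin_purel; lin
    end
  | |- GRing.linear_for _ (fun x => (@?F x) * (@?G x)) =>
    lazymatch F with
    | (fun _ => ?c) => apply: lin_mulr; lin
    | _ => apply: lin_mull; lin
    end
  | |- GRing.linear_for _ (fun x => tmul (@?F x) (@?G x)) =>
    lazymatch F with
    | (fun _ => ?c) => apply: lin_tmulr; lin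
    | _ => apply: lin_tmull; lin
    end
  | |- GRing.linear_for _ (fun x => (@?F x) *: (@?G x)) =>
    lazymatch F with
    | (fun _ => ?c) => apply: lin_scaler; lin
    | _ => apply: lin_scalel; lin
    end
  | b : bilin ?f |- GRing.linear_for _ (fun x => ?f (@?F x) (@?G x)) =>
    lazymatch F with
    | (fun _ => ?c) => apply: (lin_bilinr _ b); lin
    | _ => apply: (lin_bilinl _ b); lin
    end
  | |- GRing.linear_for _ (fun x => ?f (@?F x)) =>
    first
    [ lazymatch goal with
      | Hf : GRing.linear_for _ f |- _ => apply: (lin_comp Hf); lin
      end
    | apply: lin_app; lin
    | apply: lin_apps; lin
    | solve [auto] ]
  | |- GRing.linear_for _ (fun x => _) => solve [auto]
  | |- @GRing.linear_for ?R ?U ?V ?s ?f =>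
    first [solve [auto] |
           change (@GRing.linear_for R U V s (fun x => f x)); lin]
  end.

Section TensorMulTheory.
Variables (K : fieldType).
Implicit Types (A B : kalg K) (V W X U : lmodType K).

Lemma tmul_pure A B (a c : A) (b d : B) :
  tmul (a *t b) (c *t d) = (a * c) *t (b * d).
Proof. by rewrite /tmul !tlift_pure //; lin. Qed.

Lemma linear_ext V W U (f g : V \ox W -> U) : linear f -> linear g ->
  (forall v w, f (v *t w) = g (v *t w)) -> f =1 g.
Proof.
move=> lf lg fg x.
by rewrite -[x]tlift_purew !linear_tlift //; apply: eq_tlift => v w.
Qed.

Lemma tmulA A B (x y z : A \ox B) : tmul x (tmul y z) = tmul (tmul x y) z.
Proof.
apply: (linear_ext (f := fun x => tmul x (tmul y z))
                   (g := fun x => tmul (tmul x y) z)) => [||a b]; [lin|lin|].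
apply: (linear_ext (f := fun y => tmul (a *t b) (tmul y z))
                   (g := fun y => tmul (tmul _ y) z)) => [||c d]; [lin|lin|].
apply: (linear_ext (f := fun z => tmul (a *t b) (tmul (c *t d) z))
                   (g := fun z => tmul (tmul _ _) z)) => [||e f]; [lin|lin|].
by rewrite !tmul_pure !mulrA.
Qed.

Lemma tmul1r A B (x : A \ox B) : tmul x ((1 : A) *t (1 : B)) = x.
Proof.
apply: (linear_ext (f := fun x : A \ox B => tmul x ((1 : A) *t (1 : B))) (g :=
  id)) => [||a b];
  [lin|by []|].
by rewrite tmul_pure !mulr1.
Qed.

End TensorMulTheory.

Section LinearFacts.
Variables (K : fieldType) (V W : lmodType K) (f : V -> W).
Hypothesis lf : linear f.

Lemma linZ k v : f (k *: v) = k *: f v.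
Proof. exact: (GRing.scalable_linear lf). Qed.

Lemma lin0 : f 0 = 0.
Proof. by rewrite -[X in f X](scale0r 0) linZ scale0r. Qed.

Lemma linD x y : f (x + y) = f x + f y.
Proof. by have := lf 1 x y; rewrite !scale1r. Qed.

Lemma linN x : f (- x) = - f x.
Proof. by rewrite -scaleN1r linZ scaleN1r. Qed.

End LinearFacts.

(** * Trilinear maps and coassociativity *)

Section Trilift.
Variables (K : fieldType) (V W X U : lmodType K) (F : V -> W -> X -> U).
Hypothesis tF : trilin F.

Definition trilift (x : V \ox (W \ox X)) : U :=
  \tsum_(v *t y <- x) \tsum_(w *t z <- y) F v w z.

Lemma trilift_bilin : bilin (fun v (y : W \ox X) => \tsum_(w *t z <- y) F v w
  z).
Proof.
case: tF => F1 F2 F3; split=> [y|v]; cbv beta; first by apply: lin_tlift_body.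
by apply: lin_tlift_arg; first exact: lin_id; split.
Qed.

Lemma trilift_linear : linear trilift.
Proof. exact/tlift_linear/trilift_bilin. Qed.

Lemma trilift_pure v w z : trilift (v *t (w *t z)) = F v w z.
Proof.
case: tF => F1 F2 F3; rewrite /trilift tlift_pure; last exact: trilift_bilin.
by rewrite tlift_pure.
Qed.

Lemma trilift_tsum2 (P Q R T : lmodType K) (x : P \ox Q) (y : P -> Q -> R \ox T)
    (a : P -> Q -> R -> T -> V) (b : P -> Q -> R -> T -> W)
    (c : P -> Q -> R -> T -> X) :
  trilift (\tsum_(i *t j <- x) \tsum_(k *t l <- y i j)
    (a i j k l *t (b i j k l *t c i j k l))) =
  \tsum_(i *t j <- x) \tsum_(k *t l <- y i j)
    F (a i j k l) (b i j k l) (c i j k l).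
Proof.
rewrite (linear_tlift _ _ trilift_linear); apply: eq_tlift => i j.
rewrite (linear_tlift _ _ trilift_linear); apply: eq_tlift => k l.
exact: trilift_pure.
Qed.

(** By the universal property, an equality of sums of pure triple tensors may be evaluated by any
    trilinear [F]. Coassociativity and the bicomodule law are used through this form. *)
Lemma tsum2_trilin (P Q R T P' Q' R' T' : lmodType K)
    (x : P \ox Q) (y : P -> Q -> R \ox T)
    (a : P -> Q -> R -> T -> V) (b : P -> Q -> R -> T -> W)
    (c : P -> Q -> R -> T -> X)
    (x' : P' \ox Q') (y' : P' -> Q' -> R' \ox T')
    (a' : P' -> Q' -> R' -> T' -> V) (b' : P' -> Q' -> R' -> T' -> W)
    (c' : P' -> Q' -> R' -> T' -> X) :
  \tsum_(i *t j <- x) \tsum_(k *t l <- y i j)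
    (a i j k l *t (b i j k l *t c i j k l)) =
  \tsum_(i *t j <- x') \tsum_(k *t l <- y' i j)
    (a' i j k l *t (b' i j k l *t c' i j k l)) ->
  \tsum_(i *t j <- x) \tsum_(k *t l <- y i j)
    F (a i j k l) (b i j k l) (c i j k l) =
  \tsum_(i *t j <- x') \tsum_(k *t l <- y' i j)
    F (a' i j k l) (b' i j k l) (c' i j k l).
Proof. by move=> /(congr1 trilift); rewrite !trilift_tsum2. Qed.

End Trilift.

(** Here [D] is a bare map, so that the notion covers coactions of [H], coactions over the
    co-opposite comultiplication, and, with [rho] equal to [D], coassociativity itself. *)
Definition coaction_assoc (K : fieldType) (V C : lmodType K)
    (rho : V -> V \ox C) (D : C -> C \ox C) :=
  forall v,
    \tsum_(v0 *t h <- rho v) \tsum_(v00 *t v01 <- rho v0) (v00 *t (v01 *t h)) =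
    \tsum_(v0 *t h <- rho v) \tsum_(h1 *t h2 <- D h) (v0 *t (h1 *t h2)).

Lemma coaction_assocE (K : fieldType) (V C U : lmodType K)
    (rho : V -> V \ox C) (D : C -> C \ox C) (F : V -> C -> C -> U) :
  coaction_assoc rho D -> trilin F -> forall v,
  \tsum_(v0 *t h <- rho v) \tsum_(v00 *t v01 <- rho v0) F v00 v01 h =
  \tsum_(v0 *t h <- rho v) \tsum_(h1 *t h2 <- D h) F v0 h1 h2.
Proof.
by move=> rhoA tF v; exact: (tsum2_trilin tF (rhoA v)).
Qed.

(** * The antipode and the integral *)

Section HopfTheory.
Variables (K : fieldType) (H : hopf K).
Local Notation S := (antipode H).
Local Notation D := (Delta H).
Local Notation e := (counit H).
Implicit Types (g h x y : H) (U : lmodType K).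

Lemma DeltaA U (F : H -> H -> H -> U) : trilin F -> forall h,
  \tsum_(a *t b <- D h) \tsum_(a1 *t a2 <- D a) F a1 a2 b =
  \tsum_(a *t b <- D h) \tsum_(b1 *t b2 <- D b) F a b1 b2.
Proof. by move=> tF; apply: coaction_assocE => //; apply: hopf_coassoc. Qed.

Lemma counitlE U (F : H -> U) h : linear F ->
  \tsum_(a *t b <- D h) (e a *: F b) = F h.
Proof.
move=> lF; rewrite -{2}[h]hopf_counitl (linear_tlift _ _ lF).
by apply: eq_tlift => a b; rewrite (linZ lF).
Qed.

Lemma counitrE U (F : H -> U) h : linear F ->
  \tsum_(a *t b <- D h) (e b *: F a) = F h.
Proof.
move=> lF; rewrite -{2}[h]hopf_counitr (linear_tlift _ _ lF).
by apply: eq_tlift => a b; rewrite (linZ lF).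
Qed.

Lemma antipodelE U (F : H -> U) h : linear F ->
  \tsum_(a *t b <- D h) F (S a * b) = e h *: F 1.
Proof.
by move=> lF; rewrite -(linear_tlift _ _ lF) hopf_antipodel (linZ lF).
Qed.

Lemma antipoderE U (F : H -> U) h : linear F ->
  \tsum_(a *t b <- D h) F (a * S b) = e h *: F 1.
Proof.
by move=> lF; rewrite -(linear_tlift _ _ lF) hopf_antipoder (linZ lF).
Qed.

Lemma DeltaM g h : D (g * h) = tmul (D g) (D h).
Proof. exact: hopf_DeltaM. Qed.

Lemma DeltaME U (F : H -> H -> U) g h : bilin F ->
  \tsum_(a *t b <- D (g * h)) F a b =
  \tsum_(a *t b <- D g) \tsum_(c *t d <- D h) F (a * c) (b * d).
Proof.
move=> bF; rewrite hopf_DeltaM tlift_tlift //; apply: eq_tlift => a b.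
by rewrite tlift_tlift //; apply: eq_tlift => c d; rewrite tlift_pure.
Qed.

Lemma antipode1 : S 1 = 1.
Proof.
have := hopf_antipodel (1 : H); rewrite hopf_Delta1 tlift_pure; last by lin.
by rewrite mulr1 hopf_counit1 scale1r.
Qed.

(** Insert $h_2S(h_3)$ on the right to get $S(g_1h_1)g_2h_2S(h_3)$; multiplicativity of $\Delta$ and
    the antipode axiom for $gh$ collapse the first three factors. *)
Lemma antipode_mul_cancel g h :
  \tsum_(a *t b <- D g) (S (a * h) * b) = e g *: S h.
Proof.
transitivity (\tsum_(a *t b <- D g) \tsum_(h1 *t h2 <- D h)
   \tsum_(h3 *t h4 <- D h2) (S (a * h1) * b * (h3 * S h4))).
  apply: eq_tlift => a b.
  rewrite -{1}(counitrE h (F := fun h => S (a * h) * b)); last by lin.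
  apply: eq_tlift => h1 h2; rewrite (antipoderE (F := fun x => _ * x)) ?mulr1
    //.
  by lin.
transitivity (\tsum_(h1 *t h2 <- D h) (e h1 *: (e g *: S h2))); last first.
  by rewrite counitlE //; lin.
transitivity (\tsum_(h1 *t h2 <- D h) \tsum_(h3 *t h4 <- D h1)
   \tsum_(a *t b <- D g) (S (a * h3) * (b * h4) * S h2)).
  rewrite exchange_tlift (DeltaA (F := fun h1 h2 h3 => \tsum_(a *t b <- D g)
    (S (a * h1) * (b * h2) * S h3))); last by lin.
  apply: eq_tlift => h1 h2; rewrite exchange_tlift; apply: eq_tlift => a b.
  by apply: eq_tlift => h3 h4; rewrite !mulrA.
apply: eq_tlift => h1 h2; rewrite exchange_tlift.
rewrite -(DeltaME (F := fun x y => S x * y * S h2)); last by lin.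
rewrite (antipodelE (F := fun x => x * S h2)); last by lin.
by rewrite hopf_counitM mul1r mulrC scalerA.
Qed.

(** Insert $g_2S(g_3)$ after $S(g_1h)$ and cancel $S(g_1h)g_2$ by the preceding lemma. *)
Lemma antipodeM g h : S (g * h) = S h * S g.
Proof.
transitivity (\tsum_(a *t b <- D g) \tsum_(b1 *t b2 <- D b)
   (S (a * h) * (b1 * S b2))).
  rewrite -{1}(counitrE g (F := fun g => S (g * h))); last by lin.
  apply: eq_tlift => a b; rewrite (antipoderE (F := fun x => _ * x)) ?mulr1 //.
  by lin.
rewrite -(DeltaA (F := fun a b c => S (a * h) * (b * S c))); last by lin.
transitivity (\tsum_(a *t b <- D g) (e a *: (S h * S b))); last first.
  by rewrite counitlE //; lin.
apply: eq_tlift => a b; rewrite kscalerAl -antipode_mul_cancel.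
rewrite (linear_tlift (g := fun x => x * S b)); last by lin.
by apply: eq_tlift => c d; rewrite mulrA.
Qed.

(** Insert $y_3S(y_4)$ in the second factor: then $\Delta(S(y_1))\Delta(y_2)=\Delta(S(y_1)y_2)$
    collapses and only $1\otimes S(y)$ is left. *)
Lemma Delta_antipode_cancel y :
  \tsum_(a *t b <- D y) tmul (D (S a)) (b *t (1 : H)) = (1 : H) *t S y.
Proof.
transitivity (\tsum_(a *t b <- D y) \tsum_(b1 *t b2 <- D b)
   \tsum_(c *t d <- D b2) tmul (D (S a)) (b1 *t (c * S d))).
  apply: eq_tlift => a b.
  rewrite -{1}(counitrE b (F := fun b => tmul (D (S a)) (b *t (1 : H))));
    last by lin.
  apply: eq_tlift => b1 b2.
  by rewrite (antipoderE (F := fun x => tmul (D (S a)) (b1 *t x))) //; lin.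
transitivity (\tsum_(a *t b <- D y) \tsum_(b1 *t b2 <- D b)
   tmul (tmul (D (S a)) (D b1)) ((1 : H) *t S b2)).
  apply: eq_tlift => a b.
  rewrite -(DeltaA (F := fun b c d => tmul (D (S a)) (b *t (c * S d))));
    last by lin.
  apply: eq_tlift => b1 b2; rewrite -[in RHS](tlift_purew (D b1)).
  rewrite (linear_tlift (g := fun x : H \ox H =>
    tmul (tmul (D (S a)) x) ((1 : H) *t S b2))); last by lin.
  by apply: eq_tlift => c d; rewrite -tmulA tmul_pure mulr1.
rewrite -(DeltaA (F := fun a b c =>
  tmul (tmul (D (S a)) (D b)) ((1 : H) *t S c))); last by lin.
rewrite -(counitlE y (F := fun y => (1 : H) *t S y)); last by lin.
apply: eq_tlift => a b.
rewrite -(linear_tlift (g := fun x : H \ox H => tmul x ((1 : H) *t S b)));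
  last by lin.
transitivity (tmul (\tsum_(v *t w <- D a) D (S v * w)) ((1 : H) *t S b)).
  by congr tmul; apply: eq_tlift => v w; rewrite DeltaM.
rewrite -linear_tlift; last by lin.
by rewrite hopf_antipodel linearZ /= hopf_Delta1 (linZ (f := fun x : H \ox H =>
  tmul x _))
  ?tmul_pure ?mul1r //; lin.
Qed.

(** Multiply $\Delta(S(y_1))$ by $y_2S(y_3)\otimes 1$ and apply the previous cancellation to the
    first two factors. *)
Lemma Delta_antipode y : D (S y) = \tsum_(a *t b <- D y) (S b *t S a).
Proof.
transitivity (\tsum_(a *t b <- D y) \tsum_(b1 *t b2 <- D b)
   tmul (tmul (D (S a)) (b1 *t (1 : H))) (S b2 *t (1 : H))).
  rewrite -{1}(counitrE y (F := fun y => D (S y))); last by lin.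
  apply: eq_tlift => a b.
  rewrite -[D (S a)]tmul1r.
  rewrite -(antipoderE (F := fun x => tmul (D (S a)) (x *t (1 : H))));
    last by lin.
  by apply: eq_tlift => b1 b2; rewrite -tmulA tmul_pure mulr1 tmul1r.
rewrite -(DeltaA (F := fun a b c => tmul (tmul (D (S a)) (b *t (1 : H))) (S c
  *t (1 : H))));
  last by lin.
apply: eq_tlift => a b.
rewrite -(linear_tlift (g := fun x : H \ox H => tmul x (S b *t (1 : H))));
  last by lin.
by rewrite Delta_antipode_cancel tmul_pure mul1r mulr1.
Qed.

Lemma Delta_antipode_cancelr y :
  \tsum_(a *t b <- D y) tmul ((1 : H) *t a) (D (S b)) = S y *t (1 : H).
Proof.
transitivity (\tsum_(a *t b <- D y) \tsum_(b1 *t b2 <- D b) (S b2 *t (a * S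
  b1))).
  apply: eq_tlift => a b; rewrite Delta_antipode linear_tlift; last by lin.
  by apply: eq_tlift => c d; rewrite tmul_pure mul1r.
rewrite -(DeltaA (F := fun a b c => S c *t (a * S b))); last by lin.
rewrite -(counitlE y (F := fun y => S y *t (1 : H))); last by lin.
apply: eq_tlift => a b.
by rewrite (antipoderE (F := fun x => S b *t x)) //; lin.
Qed.

End HopfTheory.

(** * The flip of tensor factors *)

Section Swap.
Variables (K : fieldType).

Definition tswap (V W : lmodType K) (x : V \ox W) : W \ox V :=
  \tsum_(v *t w <- x) (w *t v).

Lemma tswap_linear (V W : lmodType K) : linear (@tswap V W).
Proof. by apply: tlift_linear; lin. Qed.
HB.instance Definition _ (V W : lmodType K) :=
  GRing.isLinear.Build K (V \ox W) (W \ox V) *:%R (@tswap V W)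
    (@tswap_linear V W).

Lemma tswap_pure (V W : lmodType K) (v : V) (w : W) : tswap (v *t w) = w *t v.
Proof. by rewrite /tswap tlift_pure //; lin. Qed.

Lemma tlift_tswap (V W U : lmodType K) (x : V \ox W) (F : W -> V -> U) :
  bilin F -> tlift (tswap x) F = \tsum_(v *t w <- x) F w v.
Proof.
move=> bF; rewrite /tswap tlift_tlift //; apply: eq_tlift => v w.
by rewrite tlift_pure.
Qed.

End Swap.

(** What averaging needs from the integral, in a form that serves both sides. [pairing_shift] makes
    averages colinear, [pairing_diag] makes averaging fix colinear maps, [pairing_mull] and
    [pairing_mulr] let it commute with multiplication by colinear maps, and [pairing1] preserves the
    unit. *)
Record invariant_pairing (K : fieldType) (C : kalg K) (D : C -> C \ox C)
    (e : C -> K) (beta : C -> C -> K) : Prop := InvariantPairing {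
  pairing_bilin : bilin (beta : C -> C -> K^o);
  pairing_shift : forall x y,
    \tsum_(x1 *t x2 <- D x) (beta x2 y *: x1) =
    \tsum_(y1 *t y2 <- D y) (beta x y1 *: y2);
  pairing_diag : forall x, \tsum_(x1 *t x2 <- D x) (beta x1 x2 : K^o) = e x;
  pairing_mull : forall h x y,
    \tsum_(h1 *t h2 <- D h) (beta (h1 * x) (h2 * y) : K^o) = e h *: (beta x y :
      K^o);
  pairing_mulr : forall h x y,
    \tsum_(h1 *t h2 <- D h) (beta (x * h1) (y * h2) : K^o) = e h *: (beta x y :
      K^o);
  pairing1 : beta 1 1 = 1
}.

(** * The two pairings defined by the integral *)

Section Integral.
Variables (K : fieldType) (H : hopf K) (lam : {scalar H}).
Hypothesis hlam : ad_invariant_integral lam.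
Local Notation S := (antipode H).
Local Notation D := (Delta H).
Local Notation e := (counit H).
Implicit Types (g h x y : H).

(** Write $\Delta(x)(1\otimes S(y))$ as $\Delta(xS(y_1))(y_2\otimes 1)$ and apply the integral
    property to $xS(y_1)$. *)
Lemma integral_shift x y :
  \tsum_(x1 *t x2 <- D x) (lam (x2 * S y) *: x1) =
  \tsum_(y1 *t y2 <- D y) (lam (x * S y1) *: y2).
Proof.
pose phi (u : H \ox H) := \tsum_(a *t b <- u) (lam b *: a).
have lphi : linear phi by apply: tlift_linear; lin.
have phiM (u v : H) z :
    phi (tmul z (u *t v)) = \tsum_(a *t b <- z) (lam (b * v) *: (a * u)).
  rewrite -{1}[z]tlift_purew.
  rewrite (linear_tlift (g := fun z : H \ox H => phi (tmul z (u *t v))));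
    last by apply: lin_comp => //; lin.
  apply: eq_tlift => a b; rewrite tmul_pure /phi tlift_pure //; lin.
transitivity (phi (tmul (D x) ((1 : H) *t S y))).
  by rewrite phiM; apply: eq_tlift => a b; rewrite mulr1.
rewrite -Delta_antipode_cancel.
rewrite (linear_tlift (g := fun z : H \ox H => phi (tmul (D x) z)));
  last by apply: lin_comp => //; lin.
apply: eq_tlift => y1 y2; rewrite tmulA -DeltaM phiM.
transitivity ((lam (x * S y1) *: (1 : H)) * (y2 : H));
  last by rewrite -kscalerAl mul1r.
rewrite -(adint_integral hlam) (linear_tlift (g := fun z : H => z * y2));
  last by lin.
by apply: eq_tlift => a b; rewrite mulr1 kscalerAl.
Qed.

(** The shift at $x=1$ reads $\lambda(S(y))1=\sum\lambda(S(y_1))y_2$. Applying $\lambda$ and then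
    $\sum\lambda(y_2)y_1=\lambda(y)1$ leaves $\lambda(S(\lambda(y)1))=\lambda(y)$. *)
Lemma integral_antipode y : lam (S y) = lam y.
Proof.
have := integral_shift 1 y; rewrite hopf_Delta1 tlift_pure; last by lin.
rewrite mul1r => /(congr1 lam); rewrite linearZ /= adint_one // mulr1 => ->.
transitivity (lam (S (lam y *: (1 : H)))); last first.
  by rewrite linearZ /= linearZ /= antipode1 adint_one // mulr1.
rewrite -(adint_integral hlam).
rewrite (linear_tlift (U' := K^o) (g := fun z => lam z : K^o)); last by lin.
rewrite (linear_tlift (U' := K^o) (g := fun z => lam (S z) : K^o)); last by lin.
by apply: eq_tlift => a b; rewrite !linearZ /= mulrC mul1r.
Qed.

Lemma right_integral h :
  \tsum_(h1 *t h2 <- D h) (lam h1 *: h2) = lam h *: (1 : H).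
Proof.
have := integral_shift 1 h; rewrite hopf_Delta1 tlift_pure; last by lin.
rewrite mul1r integral_antipode => ->; apply: eq_tlift => a b.
by rewrite mul1r integral_antipode.
Qed.

(** The mirror image of [integral_shift]: $(S(y)\otimes 1)\Delta(x)=\sum(1\otimes
    y_1)\Delta(S(y_2)x)$, followed by [right_integral]. *)
Lemma integral_shift_cop x y :
  \tsum_(x1 *t x2 <- D x) (lam (S y * x1) *: x2) =
  \tsum_(y1 *t y2 <- D y) (lam (S y2 * x) *: y1).
Proof.
pose phi (u : H \ox H) := \tsum_(a *t b <- u) (lam a *: b).
have lphi : linear phi by apply: tlift_linear; lin.
have phiM (u v : H) z :
    phi (tmul (u *t v) z) = \tsum_(a *t b <- z) (lam (u * a) *: (v * b)).
  rewrite -{1}[z]tlift_purew.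
  rewrite (linear_tlift (g := fun z : H \ox H => phi (tmul (u *t v) z)));
    last by apply: lin_comp => //; lin.
  apply: eq_tlift => a b; rewrite tmul_pure /phi tlift_pure //; lin.
transitivity (phi (tmul (S y *t (1 : H)) (D x))).
  by rewrite phiM; apply: eq_tlift => a b; rewrite mul1r.
rewrite -Delta_antipode_cancelr.
rewrite (linear_tlift (g := fun z : H \ox H => phi (tmul z (D x))));
  last by apply: lin_comp => //; lin.
apply: eq_tlift => y1 y2; rewrite -tmulA -DeltaM phiM.
transitivity ((y1 : H) * (lam (S y2 * x) *: (1 : H)));
  last by rewrite -kscalerAr mulr1.
rewrite -right_integral (linear_tlift (g := fun z : H => y1 * z)); last by lin.
by apply: eq_tlift => a b; rewrite mul1r kscalerAr.
Qed.

Lemma counit_antipode h : e (S h) = e h.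
Proof.
have := congr1 e (hopf_antipodel h).
rewrite (linear_tlift (U' := K^o) (g := fun z => e z : K^o)); last by lin.
rewrite linearZ /= hopf_counit1 mulr1 => <-.
rewrite -{1}(counitrE h (U := K^o) (F := fun z => e (S z) : K^o)); last by lin.
by apply: eq_tlift => a b; rewrite hopf_counitM mulrC.
Qed.

(** This is ad-invariance for $S(h)$ and $S(x)$, read back through $\lambda\circ S=\lambda$; the
    antipode reverses both products and coproducts. *)
Lemma integral_ad_antipode h x :
  \tsum_(h1 *t h2 <- D h) (lam (S h1 * x * h2) : K^o) = e h *: (lam x : K^o).
Proof.
rewrite -(integral_antipode x) -counit_antipode.
transitivity (\tsum_(h1 *t h2 <- D (S h)) (lam (h1 * S x * S h2) : K^o)).
  rewrite Delta_antipode tlift_tlift; last by lin.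
  apply: eq_tlift => a b; rewrite tlift_pure; last by lin.
  by rewrite -integral_antipode !antipodeM mulrA.
exact: (adint_ad hlam).
Qed.

(** Left invariance is ad-invariance of $\lambda$; right invariance holds already inside $\lambda$,
    where $h_1S(h_2)$ collapses. *)
Lemma right_pairing :
  invariant_pairing D e (fun x y => lam (x * S y) ).
Proof.
split=> [||x|h x y|h x y|]; first by lin.
- exact: integral_shift.
- rewrite -(linear_tlift (g := fun z => lam z : K^o)); last by lin.
  by rewrite hopf_antipoder linearZ /= adint_one // mulr1.
- rewrite -[RHS](adint_ad hlam); apply: eq_tlift => a b.
  by rewrite antipodeM !mulrA.
- transitivity (\tsum_(h1 *t h2 <- D h) (lam (x * (h1 * S h2) * S y) : K^o)).
    by apply: eq_tlift => a b; rewrite antipodeM !mulrA.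
  rewrite (antipoderE (U := K^o) (F := fun z => lam (x * z * S y) : K^o))
    ?mulr1 //.
  by lin.
- by rewrite antipode1 mulr1 adint_one.
Qed.

(** The comultiplication is flipped because a left coaction, once flipped, is a right coaction of
    the co-opposite coalgebra. The two invariances exchange their reasons: the left one is now an
    antipode cancellation, the right one is [integral_ad_antipode]. *)
Lemma left_pairing :
  invariant_pairing (fun x => tswap (D x)) e (fun x y => lam (S y * x) ).
Proof.
split=> [|x y|x|h x y|h x y|]; first by lin.
- by rewrite !tlift_tswap; [exact: integral_shift_cop|lin|lin].
- rewrite tlift_tswap; last by lin.
  rewrite -(linear_tlift (g := fun z => lam z : K^o)); last by lin.
  by rewrite hopf_antipodel linearZ /= adint_one // mulr1.
- rewrite tlift_tswap; last by lin.
  transitivity (\tsum_(h1 *t h2 <- D h) (lam (S y * (S h1 * h2) * x) : K^o)).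
    by apply: eq_tlift => a b; rewrite antipodeM !mulrA.
  rewrite (antipodelE (U := K^o) (F := fun z => lam (S y * z * x) : K^o))
    ?mulr1 //.
  by lin.
- rewrite tlift_tswap; last by lin.
  rewrite -[RHS]integral_ad_antipode; apply: eq_tlift => a b.
  by rewrite antipodeM !mulrA.
- by rewrite antipode1 mul1r adint_one.
Qed.

End Integral.

(** * Averaging *)

Definition colinear (K : fieldType) (V W C : lmodType K)
    (rhoV : V -> V \ox C) (rhoW : W -> W \ox C) (f : V -> W) :=
  forall v, rhoW (f v) = \tsum_(v0 *t h <- rhoV v) (f v0 *t h).

(** The bicomodule compatibility once the left coaction has been flipped to the right. *)
Definition coactions_commute (K : fieldType) (V C C' : lmodType K)
    (rho : V -> V \ox C) (rho' : V -> V \ox C') :=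
  forall v,
    \tsum_(v0 *t d <- rho' v) \tsum_(v00 *t g <- rho v0) (v00 *t (g *t d)) =
    \tsum_(v0 *t g <- rho v) \tsum_(v00 *t d <- rho' v0) (v00 *t (g *t d)).

Lemma coactions_commuteE (K : fieldType) (V C C' U : lmodType K)
    (rho : V -> V \ox C) (rho' : V -> V \ox C') (F : V -> C -> C' -> U) :
  coactions_commute rho rho' -> trilin F -> forall v,
  \tsum_(v0 *t d <- rho' v) \tsum_(v00 *t g <- rho v0) F v00 g d =
  \tsum_(v0 *t g <- rho v) \tsum_(v00 *t d <- rho' v0) F v00 g d.
Proof.
by move=> rhoC tF v; exact: (tsum2_trilin tF (rhoC v)).
Qed.

(** The structure maps [D] and [e] are separate parameters, so that the co-opposite coalgebra of [H]
    is allowed. *)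
Record comodule_algebra (K : fieldType) (C : kalg K) (D : C -> C \ox C)
    (e : C -> K) (A : kalg K) (rho : A -> A \ox C) : Prop := {
  coact_linear : linear rho;
  coact_assoc : coaction_assoc rho D;
  coact_counit : forall a, \tsum_(a0 *t h <- rho a) (e h *: a0) = a;
  coactM : forall a b, rho (a * b) = tmul (rho a) (rho b);
  coact1 : rho 1 = (1 : A) *t (1 : C)
}.

Section Average.
Variables (K : fieldType) (C : kalg K) (D : C -> C \ox C) (e : C -> K).
Variable (beta : C -> C -> K).
Hypothesis hbeta : invariant_pairing D e beta.
Let bbeta : bilin (beta : C -> C -> K^o) := pairing_bilin hbeta.

Variables (A E : kalg K) (rhoA : A -> A \ox C) (rhoE : E -> E \ox C).
Hypothesis hA : comodule_algebra D e rhoA.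
Hypothesis hE : comodule_algebra D e rhoE.
Let lA := coact_linear hA.
Let lE := coact_linear hE.

Implicit Types (f s : A -> E) (a b : A).

(** The average of a map on $A\otimes A$ with respect to the codiagonal coaction, in curried
    form. *)
Definition average2 (B : A -> A -> E) a b : E :=
  \tsum_(a0 *t g <- rhoA a) \tsum_(b0 *t h <- rhoA b)
  \tsum_(w *t k <- rhoE (B a0 b0)) (beta k (g * h) *: w).

Definition average (f : A -> E) a : E :=
  \tsum_(a0 *t h <- rhoA a) \tsum_(w *t g <- rhoE (f a0)) (beta g h *: w).

Lemma average_linear f : linear f -> linear (average f).
Proof.
move=> lf; rewrite /average; lin.
Qed.

(** Coassociativity of [rhoE] and [pairing_shift] turn the outgoing leg of [f a0] into a leg of [h];
    coassociativity of [rhoA] then makes it the outgoing leg of [a]. *)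
Lemma average_colinear f : linear f -> colinear rhoA rhoE (average f).
Proof.
move=> lf a; rewrite /average (linear_tlift _ _ lE).
transitivity (\tsum_(a0 *t h <- rhoA a) \tsum_(w *t g <- rhoE (f a0))
   \tsum_(h1 *t h2 <- D h) (beta g h1 *: (w *t h2))).
  apply: eq_tlift => a0 h; rewrite (linear_tlift _ _ lE).
  transitivity (\tsum_(w *t g <- rhoE (f a0)) \tsum_(w0 *t g' <- rhoE w)
     (beta g h *: (w0 *t g'))).
    apply: eq_tlift => w g; rewrite (linZ lE) tliftZ.
    by rewrite tlift_purew.
  rewrite (coaction_assocE (F := fun w g1 g2 => beta g2 h *: (w *t g1))
    (coact_assoc hE)); last by lin.
  apply: eq_tlift => w g.
  transitivity (w *t (\tsum_(x1 *t x2 <- D g) (beta x2 h *: x1))).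
    rewrite linear_tlift; last by lin.
    by apply: eq_tlift => x y; rewrite pureZr.
  rewrite (pairing_shift hbeta) linear_tlift; last by lin.
  by apply: eq_tlift => x y; rewrite pureZr.
transitivity (\tsum_(a0 *t h <- rhoA a) \tsum_(a1 *t h1 <- rhoA a0)
   \tsum_(w *t g <- rhoE (f a1)) (beta g h1 *: (w *t h))).
  rewrite (coaction_assocE (F := fun a h1 h2 => \tsum_(w *t g <- rhoE (f a))
     (beta g h1 *: (w *t h2))) (coact_assoc hA)); last by lin.
  by apply: eq_tlift => a0 h; rewrite exchange_tlift.
apply: eq_tlift => a0 h.
rewrite (linear_tlift (g := fun z => z *t h)); last by lin.
apply: eq_tlift => x y; rewrite (linear_tlift (g := fun z => z *t h));
  last by lin.
by apply: eq_tlift => ? ?; rewrite pureZl.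
Qed.

(** Colinearity makes both arguments of the pairing consecutive legs of [a], and [pairing_diag]
    contracts them to the counit. *)
Lemma average_id f : linear f -> colinear rhoA rhoE f -> average f =1 f.
Proof.
move=> lf cf a.
transitivity (\tsum_(a0 *t h <- rhoA a) \tsum_(a1 *t g <- rhoA a0)
   (beta g h *: f a1)).
  apply: eq_tlift => a0 h; rewrite cf tlift_tlift; last by lin.
  by apply: eq_tlift => x y; rewrite tlift_pure //; lin.
rewrite (coaction_assocE (F := fun a g h => beta g h *: f a) (coact_assoc hA));
  last by lin.
rewrite -[in RHS](coact_counit hA a) (linear_tlift _ _ lf).
apply: eq_tlift => a0 h; rewrite -(pairing_diag hbeta) (linZ lf).
rewrite -(linear_tlift (g := fun z : K^o => z *: f a0)) //; lin.
Qed.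

Lemma average2_mul f : linear f ->
  forall a b, average2 (fun a b => f (a * b)) a b = average f (a * b).
Proof.
move=> lf a b; rewrite /average (coactM hA) tlift_tlift; last by lin.
apply: eq_tlift => a0 g; rewrite tlift_tlift; last by lin.
by apply: eq_tlift => b0 h; rewrite tlift_pure //; lin.
Qed.

(** Colinearity of [s] puts consecutive legs of [a] on the left of the two arguments of the pairing,
    where [pairing_mull] contracts them to the counit. *)
Lemma average2_mull s f : linear s -> colinear rhoA rhoE s -> linear f ->
  forall a b, average2 (fun a b => s a * f b) a b = s a * average f b.
Proof.
move=> ls cs lf a b.
transitivity (\tsum_(a0 *t g <- rhoA a) \tsum_(a1 *t g1 <- rhoA a0)
   \tsum_(b0 *t h <- rhoA b) \tsum_(w *t k <- rhoE (f b0))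
   (beta ((g1 : C) * k) ((g : C) * h) *: (s a1 * w))).
  apply: eq_tlift => a0 g; rewrite [RHS]exchange_tlift.
  apply: eq_tlift => b0 h.
  rewrite (coactM hE) cs tlift_tlift; last by lin.
  rewrite tlift_tlift; last by lin.
  apply: eq_tlift => a1 g1; rewrite tlift_pure; last by lin.
  rewrite tlift_tlift; last by lin.
  by apply: eq_tlift => w k; rewrite tlift_pure //; lin.
rewrite (coaction_assocE (F := fun (a : A) (g1 g : C) => \tsum_(b0 *t h <- rhoA
  b)
  \tsum_(w *t k <- rhoE (f b0)) (beta (g1 * k) (g * h) *: (s a * w)))
  (coact_assoc hA)); last by lin.
rewrite -[in RHS](coact_counit hA a) (linear_tlift _ _ ls).
rewrite (linear_tlift (g := fun z : E => z * average f b)); last by lin.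
apply: eq_tlift => a0 g; rewrite (linZ ls) -kscalerAl.
rewrite (linear_tlift (g := fun z : E => s a0 * z)); last by lin.
rewrite exchange_tlift -tliftZ; apply: eq_tlift => b0 h.
rewrite (linear_tlift (g := fun z : E => s a0 * z)); last by lin.
rewrite exchange_tlift -tliftZ; apply: eq_tlift => w k.
transitivity ((\tsum_(g1 *t g2 <- D g) (beta (g1 * k) (g2 * h) : K^o)) *: (s a0
  * w)).
  by rewrite (linear_tlift (g := fun z : K^o => z *: (s a0 * w))) //; lin.
by rewrite (pairing_mull hbeta) -kscalerAr scalerA.
Qed.

Lemma average2_mulr s f : linear s -> colinear rhoA rhoE s -> linear f ->
  forall a b, average2 (fun a b => f a * s b) a b = average f a * s b.
Proof.
move=> ls cs lf a b.
transitivity (\tsum_(a0 *t g <- rhoA a) \tsum_(w *t k <- rhoE (f a0))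
   \tsum_(b0 *t h <- rhoA b) \tsum_(b1 *t h1 <- rhoA b0)
   (beta ((k : C) * h1) ((g : C) * h) *: ((w : E) * s b1))).
  apply: eq_tlift => a0 g; rewrite [RHS]exchange_tlift.
  apply: eq_tlift => b0 h.
  rewrite (coactM hE) cs tlift_tlift; last by lin.
  apply: eq_tlift => w k.
  rewrite tlift_tlift; last by lin.
  rewrite tlift_tlift; last by lin.
  apply: eq_tlift => b1 h1; rewrite tlift_pure; last by lin.
  by rewrite tlift_pure //; lin.
rewrite (linear_tlift (g := fun z : E => z * s b)); last by lin.
apply: eq_tlift => a0 g.
rewrite (linear_tlift (g := fun z : E => z * s b)); last by lin.
apply: eq_tlift => w k.
rewrite (coaction_assocE (F := fun (b : A) (h1 h : C) => (beta (k * h1) (g * h)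
  *: (w * s b)))
  (coact_assoc hA)); last by lin.
rewrite -[in RHS](coact_counit hA b) (linear_tlift _ _ ls).
rewrite (linear_tlift (g := fun z : E => (beta k g *: w) * z)); last by lin.
apply: eq_tlift => b0 h; transitivity ((\tsum_(h1 *t h2 <- D h) (beta (k * h1)
  (g * h2) : K^o)) *: (w * s b0)).
  by rewrite (linear_tlift (g := fun z : K^o => z *: (w * s b0))) //; lin.
by rewrite (pairing_mulr hbeta) (linZ ls) -kscalerAr -kscalerAl scalerA.
Qed.

(** The coaction [rhoE'] passes through [rhoE] and the colinear [f], and the two coactions on [A]
    are then exchanged. Hence a second average keeps the colinearity gained by a first one. *)
Lemma average_colinear_comm (C' : kalg K) (rhoA' : A -> A \ox C')
    (rhoE' : E -> E \ox C') f : linear rhoA' -> linear rhoE' ->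
  coactions_commute rhoA rhoA' -> coactions_commute rhoE rhoE' ->
  linear f -> colinear rhoA' rhoE' f -> colinear rhoA' rhoE' (average f).
Proof.
move=> lA' lE' cA cE lf cf a; rewrite {1}/average (linear_tlift _ _ lE').
transitivity (\tsum_(a0 *t h <- rhoA a) \tsum_(a1 *t d <- rhoA' a0)
   \tsum_(w *t g <- rhoE (f a1)) (beta g h *: (w *t d))).
  apply: eq_tlift => a0 h; rewrite (linear_tlift _ _ lE').
  transitivity (\tsum_(w *t g <- rhoE (f a0)) \tsum_(w0 *t d <- rhoE' w)
     (beta g h *: (w0 *t d))).
    apply: eq_tlift => w g; rewrite (linZ lE') tliftZ.
    by rewrite tlift_purew.
  rewrite -(coactions_commuteE (F := fun w g d => beta g h *: (w *t d)) cE);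
    last by lin.
  rewrite cf tlift_tlift; last by lin.
  by apply: eq_tlift => a1 d; rewrite tlift_pure //; lin.
rewrite -(coactions_commuteE (F := fun a h d => \tsum_(w *t g <- rhoE (f a))
  (beta g h *: (w *t d))) cA); last by lin.
apply: eq_tlift => a0 d.
rewrite (linear_tlift (g := fun z : E => z *t d)); last by lin.
apply: eq_tlift => x y; rewrite (linear_tlift (g := fun z : E => z *t d));
  last by lin.
by apply: eq_tlift => ? ?; rewrite pureZl.
Qed.

Lemma average_unit f : linear f ->
  average f 1 = \tsum_(w *t g <- rhoE (f 1)) (beta g 1 *: w).
Proof.
move=> lf; rewrite /average (coact1 hA) tlift_pure //; lin.
Qed.

Lemma average_unit0 f : linear f -> f 1 = 0 -> average f 1 = 0.
Proof.
move=> lf f1; rewrite average_unit // f1 (lin0 lE).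
by apply: (lin0 (tlift_linear _)); lin.
Qed.

Lemma average_unit1 f : linear f -> f 1 = 1 -> average f 1 = 1.
Proof.
move=> lf f1; rewrite average_unit // f1 (coact1 hE) tlift_pure; last by lin.
by rewrite (pairing1 hbeta) scale1r.
Qed.

(** Being colinear, [p] passes inside the average, which becomes the average of the identity of [A];
    [pairing_diag] evaluates it. *)
Lemma average_section (p : E -> A) f : linear p -> colinear rhoE rhoA p ->
  linear f -> cancel f p -> cancel (average f) p.
Proof.
move=> lp cp lf fK a; rewrite /average (linear_tlift _ _ lp).
transitivity (\tsum_(a0 *t h <- rhoA a) \tsum_(a1 *t g <- rhoA a0)
   (beta g h *: a1)).
  apply: eq_tlift => a0 h; rewrite (linear_tlift _ _ lp).
  rewrite -[in RHS](fK a0) cp tlift_tlift; last by lin.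
  apply: eq_tlift => x y; rewrite tlift_pure; last by lin.
  by rewrite (linZ lp).
rewrite (coaction_assocE (F := fun a g h => beta g h *: a) (coact_assoc hA));
  last by lin.
rewrite -[in RHS](coact_counit hA a); apply: eq_tlift => a0 h.
rewrite -(pairing_diag hbeta).
by rewrite (linear_tlift (g := fun z : K^o => z *: a0)) //; lin.
Qed.

End Average.

(** * Powers of the kernel *)

Section IdealPowers.
Variables (K : fieldType) (A E : kalg K) (p : E -> A).
Hypotheses (lp : linear p) (pM : forall x y, p (x * y) = p x * p y).

(** The powers of the ideal $\ker p$, the zeroth being all of [E]. Generating them by right factors
    from the kernel gives an induction principle without explicit sums of products. *)
Inductive kerpow : nat -> E -> Prop :=
| kerpow0 x : kerpow 0 x
| kerpow_zero n : kerpow n 0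
| kerpowD n x y : kerpow n x -> kerpow n y -> kerpow n (x + y)
| kerpowM n x y : kerpow n x -> p y = 0 -> kerpow n.+1 (x * y).

Lemma kerpowMr n x y : kerpow n x -> kerpow n (x * y).
Proof.
move=> nx; elim: nx y => {n x} [x|n|n x z _ IHx _ IHz|n x z nx _ pz] y.
- exact: kerpow0.
- by rewrite mul0r; apply: kerpow_zero.
- by rewrite mulrDl; apply: kerpowD.
- by rewrite -mulrA; apply: kerpowM => //; rewrite pM pz mul0r.
Qed.

Lemma kerpowMl n x y : kerpow n x -> kerpow n (y * x).
Proof.
move=> nx; elim: nx y => {n x} [x|n|n x z _ IHx _ IHz|n x z nx IHx pz] y.
- exact: kerpow0.
- by rewrite mulr0; apply: kerpow_zero.
- by rewrite mulrDr; apply: kerpowD.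
- by rewrite mulrA; apply: kerpowM.
Qed.

Lemma kerpowZ n k x : kerpow n x -> kerpow n (k *: x).
Proof. by rewrite -{2}[x]mul1r kscalerAl; apply: kerpowMl. Qed.

Lemma kerpowN n x : kerpow n x -> kerpow n (- x).
Proof. by rewrite -scaleN1r; apply: kerpowZ. Qed.

Lemma kerpowB n x y : kerpow n x -> kerpow n y -> kerpow n (x - y).
Proof. by move=> nx ny; apply: kerpowD => //; apply: kerpowN. Qed.

Lemma kerpow_ker n x : kerpow n.+1 x -> p x = 0.
Proof.
move eqm : n.+1 => m mx; elim: mx eqm => {m x} // [m|m x y _ IHx _ IHy|m x y _
  _ py] E1.
- exact: lin0.
- by rewrite linD // IHx // IHy // addr0.
- by rewrite pM py mulr0.
Qed.

Lemma kerpow1 x : p x = 0 -> kerpow 1 x.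
Proof. by move=> px; rewrite -[x]mul1r; apply: kerpowM => //;
  apply: kerpow0. Qed.

Lemma kerpowS n x : kerpow n.+1 x -> kerpow n x.
Proof.
move eqm : n.+1 => m mx; elim: mx n eqm => {m x} // [m|m x y _ IHx _ IHy|m x y
  mx IH py] n E1.
- exact: kerpow_zero.
- by apply: kerpowD; [apply: IHx | apply: IHy].
- by case: E1 => ->; apply: kerpowMr.
Qed.

(** The trailing kernel factors [y] strengthen the induction: each use of [kerpowM] moves its kernel
    factor to the front of this product, and the total count [N] is unchanged. *)
Lemma kerpow_prod0 n x : kerpow n x -> forall m N (y : 'I_m -> E),
  (forall z : 'I_N -> E, (forall i, p (z i) = 0) -> \prod_(i < N) z i = 0) ->
  (n + m)%N = N -> (forall i, p (y i) = 0) -> x * \prod_(i < m) y i = 0.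
Proof.
elim=> {n x} [x|n|n x z _ IHx _ IHz|n x z _ IHx pz] m N y nil eqN py.
- by subst N; rewrite nil ?mulr0.
- by rewrite mul0r.
- by rewrite mulrDl (IHx _ N) // (IHz _ N) // addr0.
(* The family [y'] is [y] with [z] prepended. *)
- pose y' i := oapp y z (unlift ord0 i).
  have <- : x * \prod_(i < m.+1) y' i = 0.
    apply: (IHx _ N _ nil); first by rewrite addnS.
    by move=> i; rewrite /y'; case: unliftP => [j|] _ /=.
  rewrite big_ord_recl {1}/y' unlift_none /= mulrA; congr (_ * _).
  by apply: eq_bigr => i _; rewrite /y' liftK.
Qed.

Lemma kerpow_nilpotent : nilpotent_ideal (fun x : E => p x = 0) ->
  exists n, forall x, kerpow n x -> x = 0.
Proof.
case=> n nil; exists n => x nx.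
(* With no trailing factor the product is empty and equals 1. *)
have := @kerpow_prod0 n x nx 0%N n (fun i => 0) nil (addn0 n).
by rewrite big_ord0 mulr1; apply=> -[].
Qed.

End IdealPowers.

(** * Averages of maps into powers of the kernel *)

Section AverageIdeal.
Variables (K : fieldType) (C : kalg K) (D : C -> C \ox C) (e : C -> K).
Variable (beta : C -> C -> K).
Hypothesis hbeta : invariant_pairing D e beta.
Let bbeta : bilin (beta : C -> C -> K^o) := pairing_bilin hbeta.

Variables (A E : kalg K) (rhoA : A -> A \ox C) (rhoE : E -> E \ox C).
Hypothesis hA : comodule_algebra D e rhoA.
Hypothesis hE : comodule_algebra D e rhoE.
Let lA := coact_linear hA.
Let lE := coact_linear hE.
Variables (p : E -> A) (r : A -> E).
Hypotheses (lp : linear p) (pM : forall x y, p (x * y) = p x * p y).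
Hypotheses (cp : colinear rhoE rhoA p) (lr : linear r) (rK : cancel r p).

(** Since [p] is colinear, $(p\otimes 1)$ kills [rhoE y], so the first legs may be projected to the
    kernel by $y_0\mapsto y_0-r(p(y_0))$. In other words the kernel is a subcomodule. *)
Lemma coact_kernel (U : lmodType K) (F : E -> C -> U) y : bilin F -> p y = 0 ->
  tlift (rhoE y) F = \tsum_(y0 *t h <- rhoE y) F (y0 - r (p y0)) h.
Proof.
move=> bF py.
have F0 : \tsum_(y0 *t h <- rhoE y) F (r (p y0)) h = 0.
  transitivity (\tsum_(a0 *t h <- rhoA (p y)) F (r a0) h).
    rewrite cp tlift_tlift; last by lin.
    by apply: eq_tlift => a h; rewrite tlift_pure //; lin.
  by rewrite py (lin0 lA) (lin0 (tlift_linear _)) //; lin.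
rewrite -[LHS]subr0 -F0 -tliftB; apply: eq_tlift => y0 h.
by have lF := bF.1 h; rewrite [RHS](linD lF) (linN lF).
Qed.

(** The powers of the kernel are subcomodules, expressed by contracting the coaction with a
    functional. The induction must vary [phi], because for a product [x * y] the factor [x] is
    contracted with $g\mapsto\varphi(gh)$. *)
Lemma kerpow_contract n x (phi : C -> K) : kerpow p n x ->
  linear (phi : C -> K^o) ->
  kerpow p n (\tsum_(w *t g <- rhoE x) (phi g *: w)).
Proof.
move=> nx lphi.
have lt (psi : C -> K) : linear (psi : C -> K^o) ->
    linear (fun x : E \ox C => \tsum_(w *t g <- x) (psi g *: w)).
  by move=> lpsi; apply: tlift_linear; lin.
elim: nx phi lphi => {n x} [x|n|n x y _ IHx _ IHy|n x y nx IHx py] phi lphi.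
- exact: kerpow0.
- by rewrite (lin0 lE) (lin0 (lt _ lphi)); exact: kerpow_zero.
- by rewrite (linD lE) (linD (lt _ lphi)); apply: kerpowD; auto.
rewrite (coactM hE) tlift_tlift; last by lin.
have -> : \tsum_(x0 *t g <- rhoE x) tlift
      (\tsum_(y0 *t h <- rhoE y) ((x0 * y0) *t (g * h)))
      (fun (w : E) (k : C) => phi k *: w) =
    \tsum_(y0 *t h <- rhoE y)
      ((\tsum_(x0 *t g <- rhoE x) (phi (g * h) *: x0)) * y0).
  transitivity (\tsum_(x0 *t g <- rhoE x) \tsum_(y0 *t h <- rhoE y)
      ((phi ((g : C) * h) *: (x0 : E)) * y0)).
    apply: eq_tlift => x0 g; rewrite tlift_tlift; last by lin.
    apply: eq_tlift => y0 h; rewrite tlift_pure; last by lin.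
    by rewrite kscalerAl.
  rewrite exchange_tlift; apply: eq_tlift => y0 h.
  by rewrite [RHS](linear_tlift (g := fun z : E => z * y0)) //; lin.
rewrite (coact_kernel (F := fun y0 h =>
  (\tsum_(x0 *t g <- rhoE x) (phi (g * h) *: x0)) * y0)) //; last by lin.
apply: tlift_pred => [|a b|y0 h]; [exact: kerpow_zero|exact: kerpowD|].
apply: kerpowM; last by rewrite linD // linN // rK subrr.
by apply: (IHx (fun g => phi (g * h))); lin.
Qed.

Lemma average_kerpow n f : linear f -> (forall a, kerpow p n (f a)) ->
  forall a, kerpow p n (average beta rhoA rhoE f a).
Proof.
move=> lf nf a; apply: tlift_pred => [|x y|a0 h].
- exact: kerpow_zero.
- exact: kerpowD.
- by apply: (kerpow_contract (phi := fun g => beta g h)) => //; lin.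
Qed.

Lemma average2_kerpow n (B : A -> A -> E) : (forall a b, kerpow p n (B a b)) ->
  forall a b, kerpow p n (average2 beta rhoA rhoE B a b).
Proof.
move=> nB a b; apply: tlift_pred => [|x y|a0 g];
  [exact: kerpow_zero|exact: kerpowD|].
apply: tlift_pred => [|x y|b0 h]; [exact: kerpow_zero|exact: kerpowD|].
by apply: (kerpow_contract (phi := fun k => beta k (g * h))) => //; lin.
Qed.

End AverageIdeal.

(** * The derivation given by formal smoothness *)

Section FreeBimodule.
Variables (K : fieldType) (A : kalg K).
Local Notation A3 := (A \ox (A \ox A)).

(** The outer actions on $A\otimes A\otimes A$ make it the free bimodule on the vector space [A],
    embedded as the middle factor. *)
Definition lact3 (a : A) (m : A3) : A3 := \tsum_(x *t w <- m) ((a * x) *t w).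
Definition ract3 (m : A3) (a : A) : A3 := \tsum_(x *t w <- m) (x *t tract w a).

Let btract := @tractP K A.
Let btlact := @tlactP K A.

Lemma lact3_bilin : bilin lact3.
Proof. by rewrite /lact3; lin. Qed.

Lemma ract3_bilin : bilin ract3.
Proof. by rewrite /ract3; lin. Qed.

Let blact3 := lact3_bilin.
Let bract3 := ract3_bilin.

Lemma lact3_pure a x w : lact3 a (x *t w) = (a * x) *t w.
Proof. by rewrite /lact3 tlift_pure //; lin. Qed.

Lemma ract3_pure x w a : ract3 (x *t w) a = x *t tract w a.
Proof. by rewrite /ract3 tlift_pure //; lin. Qed.

Lemma lact3A a b m : lact3 a (lact3 b m) = lact3 (a * b) m.
Proof.
apply: (linear_ext (f := fun m => lact3 a (lact3 b m))) => [||x w];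
  [lin|lin|by rewrite !lact3_pure mulrA].
Qed.

Lemma ract3A m a b : ract3 (ract3 m a) b = ract3 m (a * b).
Proof.
apply: (linear_ext (f := fun m => ract3 (ract3 m a) b)
  (g := fun m => ract3 m (a * b))) => [||x w];
  [lin|lin|by rewrite !ract3_pure tractA].
Qed.

Lemma lact31 m : lact3 1 m = m.
Proof.
apply: (linear_ext (f := fun m => lact3 1 m) (g := id)) => [||x w];
  [lin|by []|by rewrite lact3_pure mul1r].
Qed.

Lemma ract31 m : ract3 m 1 = m.
Proof.
apply: (linear_ext (f := fun m => ract3 m 1) (g := id)) => [||x w];
  [lin|by []|by rewrite ract3_pure tract1].
Qed.

Lemma lract3A a m b : ract3 (lact3 a m) b = lact3 a (ract3 m b).
Proof.
apply: (linear_ext (f := fun m => ract3 (lact3 a m) b)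
  (g := fun m => lact3 a (ract3 m b))) => [||x w];
  [lin|lin|by rewrite !(ract3_pure, lact3_pure)].
Qed.

Definition free_bimod : bimod A :=
  Bimod lact3_bilin ract3_bilin lact3A ract3A lact31 ract31 lract3A.

Lemma universal_derivation_subproof (a : A) :
  ((1 : A) *t a - a *t (1 : A)) \in @ker_mul K A.
Proof.
rewrite unfold_in linearB /= [X in X - _]mul_tensor_pure.
by rewrite [X in _ - X]mul_tensor_pure mul1r mulr1 subrr.
Qed.

Definition universal_derivation (a : A) : omega1 A :=
  Omega1 (universal_derivation_subproof a).
Local Notation d := universal_derivation.

Lemma universal_derivation_linear : linear d.
Proof.
move=> k a b; apply: val_inj => /=.
rewrite pureDr pureDl pureZr pureZl scalerBr.
by rewrite opprD addrACA.
Qed.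

Lemma universal_derivationM a b :
  d (a * b) = omega1_lact a (d b) + omega1_ract (d a) b.
Proof.
apply: val_inj; rewrite [RHS]/= [LHS]/=.
have lt : linear (tlact a) by exact: btlact.2.
have rt : linear (fun u : A \ox A => tract u b) by exact: btract.1.
rewrite (linD lt) (linN lt) (linD rt) (linN rt).
rewrite !tlact_pure !tract_pure mul1r mulr1 [RHS]addrC addrA.
by rewrite subrK.
Qed.

Let ld := universal_derivation_linear.
Let blO := @omega1_lact_bilin K A.
Let brO := @omega1_ract_bilin K A.

(** The bimodule map $x\otimes y\otimes z\mapsto x\,d(y)\,z$ from the free bimodule onto
    $\Omega^1A$. *)
Definition to_omega1 (m : A3) : omega1 A :=
  \tsum_(x *t w <- m) omega1_lact x (\tsum_(y *t z <- w) omega1_ract (d y) z).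

Lemma to_omega1_linear : linear to_omega1.
Proof. by apply: tlift_linear; lin. Qed.

Lemma to_omega1_pure x y z :
  to_omega1 (x *t (y *t z)) = omega1_lact x (omega1_ract (d y) z).
Proof. by rewrite /to_omega1 !tlift_pure //; lin. Qed.

Lemma to_omega1_lact a m : to_omega1 (lact3 a m) = omega1_lact a (to_omega1 m).
Proof.
have lO := to_omega1_linear.
apply: (linear_ext (f := fun m => to_omega1 (lact3 a m))
  (g := fun m => omega1_lact a (to_omega1 m))) => [||x w]; [lin|lin|].
apply: (linear_ext (f := fun w => to_omega1 (lact3 a (x *t w)))
  (g := fun w => omega1_lact a (to_omega1 (x *t w)))) => [||y z]; [lin|lin|].
rewrite lact3_pure !to_omega1_pure.
exact: (esym (@lactA _ _ (omega1_bimod A) a x _)).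
Qed.

Lemma to_omega1_ract m a : to_omega1 (ract3 m a) = omega1_ract (to_omega1 m) a.
Proof.
have lO := to_omega1_linear.
apply: (linear_ext (f := fun m => to_omega1 (ract3 m a))
  (g := fun m => omega1_ract (to_omega1 m) a)) => [||x w]; [lin|lin|].
apply: (linear_ext (f := fun w => to_omega1 (ract3 (x *t w) a))
  (g := fun w => omega1_ract (to_omega1 (x *t w)) a)) => [||y z]; [lin|lin|].
rewrite ract3_pure tract_pure !to_omega1_pure.
transitivity (omega1_lact x (omega1_ract (omega1_ract (d y) z) a)).
  congr (omega1_lact x _); exact: (esym (@ractA _ _ (omega1_bimod A) _ z a)).
exact: (esym (@lractA _ _ (omega1_bimod A) x _ a)).
Qed.

(** The negative of the bar differential; it computes [to_omega1] inside $A\otimes A$. *)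
Definition bar_diff (m : A3) : A \ox A :=
  \tsum_(x *t w <- m) \tsum_(y *t z <- w) (x *t (y * z) - (x * y) *t z).

Lemma lin_val (V : lmodType K) (G : V -> omega1 A) :
  linear G -> linear (fun x => omega1_val (G x)).
Proof. by move=> lG k x y; rewrite lG. Qed.

Lemma to_omega1_val m : omega1_val (to_omega1 m) = bar_diff m.
Proof.
have lO := to_omega1_linear.
apply: (linear_ext (f := fun m => omega1_val (to_omega1 m))) => [||x w].
- exact: lin_val.
- by apply: tlift_linear; lin.
apply: (linear_ext (f := fun w => omega1_val (to_omega1 (x *t w)))
   (g := fun w => bar_diff (x *t w))) => [||y z].
- by apply: lin_val; lin.
- by apply: lin_tlift_arg; lin.
rewrite to_omega1_pure /bar_diff tlift_pure; last by lin.
rewrite tlift_pure /=; last by lin.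
have lt : linear (tlact x) by exact: btlact.2.
have rt : linear (fun u : A \ox A => tract u z) by exact: btract.1.
rewrite (linD rt) (linN rt) (linD lt) (linN lt).
by rewrite !tract_pure !tlact_pure mul1r mulr1.
Qed.

Definition of_omega1 (w : omega1 A) : A3 :=
  \tsum_(x *t y <- omega1_val w) (x *t (y *t (1 : A))).

Lemma of_omega1_linear : linear of_omega1.
Proof. by apply: lin_tlift_arg; [exact: lin_val | lin]. Qed.

(** The bar formula sends $x\otimes y\otimes 1$ to $x\otimes y-xy\otimes 1$, and the second terms
    add up to zero on the kernel of the multiplication. This is the linear splitting that formal
    smoothness asks for. *)
Lemma of_omega1K : cancel of_omega1 to_omega1.
Proof.
move=> w; apply: val_inj; rewrite /= to_omega1_val.
have bd w' : bar_diff (\tsum_(x *t y <- w') (x *t (y *t (1 : A)))) =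
    w' - mul_tensor w' *t (1 : A).
  have lb : linear bar_diff by apply: tlift_linear; lin.
  apply: (linear_ext (f := fun w' => bar_diff (\tsum_(x *t y <- w')
     (x *t (y *t (1 : A))))) (g := fun w' => w' - mul_tensor w' *t (1 : A)))
    => [||x y].
  - by lin.
  - by apply: lin_add; [exact: lin_id|lin].
  rewrite tlift_pure; last by lin.
  rewrite /bar_diff tlift_pure; last by lin.
  rewrite tlift_pure; last by lin.
  by rewrite mulr1 mul_tensor_pure.
rewrite bd; case: w => w /= /eqP ->.
by rewrite (lin0 (f := fun a => a *t (1 : A))) ?subr0 //; lin.
Qed.

HB.instance Definition _ := GRing.isLinear.Build K A3 (omega1 A) *:%R
  to_omega1 to_omega1_linear.
HB.instance Definition _ := GRing.isLinear.Build K (omega1 A) A3 *:%R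
  of_omega1 of_omega1_linear.

(** Formal smoothness lifts the identity of $\Omega^1A$ to a bimodule section [h] of [to_omega1];
    then [T] is [h] composed with the universal derivation. *)
Lemma smooth_derivation : formally_smooth A ->
  exists T : A -> A3, [/\ linear T,
    forall a b, T (a * b) = lact3 a (T b) + ract3 (T a) b &
    forall a, bar_diff (T a) = (1 : A) *t a - a *t (1 : A)].
Proof.
move=> smooth.
have := smooth free_bimod (omega1_bimod A) (to_omega1 : {linear A3 -> omega1
  A}).
move=> /(_ _ _ (idfun : {linear omega1 A -> omega1 A})).
case=> [|||h [hl hr] hK].
- by split=> [a x|x a]; [exact: to_omega1_lact | exact: to_omega1_ract].
- by exists of_omega1; exact: of_omega1K.
- by split.
exists (fun a => h (d a)); split=> [|a b|a].
- by apply: lin_app; exact: ld.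
- rewrite universal_derivationM linearD.
  by congr (_ + _); [exact: hl | exact: hr].
- by rewrite -to_omega1_val [to_omega1 _]hK.
Qed.

End FreeBimodule.

(** * Linear sections *)

(** Zorn's lemma is applied to graphs of linear sections defined on subspaces of [W]. *)
Lemma linear_section (K : fieldType) (V W : lmodType K) (g : V -> W) :
  linear g -> (forall w, exists v, g v = w) ->
  exists2 s : W -> V, linear s & cancel s g.
Proof.
move=> lg surj.
(* Without the zero vector adjoined, the union of the empty chain would not
   be a subspace. *)
pose G0 (G : set (W * V)) (p : W * V) := p = 0 \/ G p.
pose P : set (set (W * V)) := fun G =>
  [/\ forall k p q, G0 G p -> G0 G q -> G0 G (k *: p + q),
      forall p, G0 G p -> g p.2 = p.1 &
      forall v, G0 G (0, v) -> v = 0].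
have [F FP Ftot|G [[Glin Gsec Gfun] Gmax]] := @Zorn_bigcup _ P.
  have inF X p : F X -> G0 X p -> G0 (\bigcup_(Y in F) Y)%classic p.
    by move=> FX [->|Xp]; [left|right; exists X].
  have ofF p : G0 (\bigcup_(Y in F) Y)%classic p ->
      p = 0 \/ exists2 X, F X & G0 X p.
    by case=> [->|[X FX Xp]]; [left|right; exists X => //; right].
  split=> [k p q /ofF pF /ofF qF|p /ofF[->|[X /FP[_ Xs _]]]|v /ofF[|[X /FP[_
    _]]]].
  - case: pF qF => [->|[X FX Xp]] [->|[Y FY Yq]].
    + by left; rewrite scaler0 addr0.
    + by apply: (inF Y) => //; rewrite scaler0 add0r.
    + apply: (inF X) => //; have [Xl _ _] := FP _ FX.
      by apply: Xl => //; left.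
    + have [XY|YX] := Ftot _ _ FX FY.
      * apply: (inF Y) => //; have [Yl _ _] := FP _ FY; apply: Yl => //.
        by case: Xp => [->|/XY]; [left|right].
      * apply: (inF X) => //; have [Xl _ _] := FP _ FX; apply: Xl => //.
        by case: Yq => [->|/YX]; [left|right].
  - by rewrite (lin0 lg).
  - exact: Xs.
  - by case.
  - by apply.
have total w : exists v, G0 G (w, v).
  apply: contrapT => /forallNP nw; have [v0 gv0] := surj w.
  (* [B] adjoins the line through [(w, v0)]; if [w] were outside the domain of [G], this would be a
     strictly larger partial section. *)
  pose B : set (W * V) := fun q => exists k p, G0 G p /\ q = k *: (w, v0) + p.
  have B0 q : G0 B q -> B q.
    by case=> // ->; exists 0, 0; split; [left|rewrite scale0r addr0].
  apply: (Gmax B).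
    split.
      by move=> p Gp; exists 0, p; split; [right|rewrite scale0r add0r].
    move=> /(_ (w, v0)) GB; apply: (nw v0); right; apply: GB.
    by exists 1, 0; split; [left|rewrite scale1r addr0].
  split=> [k _ _ /B0[k1 [p1 [Gp1 ->]]] /B0[k2 [p2 [Gp2 ->]]]|_ /B0[k [p [Gp
    ->]]]|v].
  - right; exists (k * k1 + k2), (k *: p1 + p2); split; first exact: Glin.
    by rewrite scalerDr scalerA addrACA -scalerDl.
  - by rewrite /= lg gv0 Gsec.
  - move=> /B0[k [p [Gp E]]]; have [k0|k0] := eqVneq k 0.
      by apply: Gfun; rewrite E k0 scale0r add0r.
    (* For nonzero [k], solving [0 = k *: w + p.1] for [w] puts a multiple of [p] over [w], against
       the assumption on [w]. *)
    case: (nw ((- k^-1) *: p.2)).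
    suff -> : (w, (- k^-1) *: p.2) = (- k^-1) *: p + 0 by apply: Glin => //;
      left.
    rewrite addr0; congr (_, _) => /=.
    have /(congr1 fst)/= := E => /esym/eqP; rewrite addr_eq0 => /eqP pw.
    by rewrite -[p.1]opprK -pw scaleNr scalerN opprK scalerA mulVf // scale1r.
(* The default 0 is never reached, since the graph is total. *)
pose s w := xget 0 [set v | G0 G (w, v)].
have sP w : G0 G (w, s w).
  by rewrite /s; case: xgetP => [x _ //|no]; have [v /no] := total w.
exists s => [k x y|w]; last exact: (Gsec _ (sP w)).
(* The graph is a subspace with only 0 over 0, so linearity follows from finding the difference over
   0. *)
apply/eqP; rewrite -subr_eq0; apply/eqP/Gfun.
have -> : (0 : W, s (k *: x + y) - (k *: s x + s y)) =
    (-1) *: (k *: (x, s x) + (y, s y)) + (k *: x + y, s (k *: x + y)).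
  by rewrite scaleN1r; congr (_, _) => /=; [rewrite addNr|rewrite addrC].
by apply: (Glin) => //; apply: Glin.
Qed.

(** * Lifting *)

Section Newton.
Variables (K : fieldType) (A E : kalg K) (p : E -> A).
Hypotheses (lp : linear p) (pM : forall x y, p (x * y) = p x * p y).

Definition curvature (s : A -> E) a b : E := s a * s b - s (a * b).

(** Minus the part of the curvature of [s + u] that is of degree at most one in [u]; it vanishes
    when the coboundary of [u] cancels the curvature. *)
Definition defect (s u : A -> E) a b : E :=
  u (a * b) - s a * u b - u a * s b - curvature s a b.

Variable s : A -> E.
Hypotheses (ls : linear s) (s1 : s 1 = 1) (sK : cancel s p).
Local Notation c := (curvature s).

Lemma curvature_bilin : bilin c.
Proof. by rewrite /curvature; split=> [b|a]; cbv beta; apply: lin_add; lin. Qed.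
Let bc := curvature_bilin.

Lemma curvature_ker a b : p (c a b) = 0.
Proof. by rewrite /curvature (linD lp) (linN lp) pM !sK subrr. Qed.

Lemma curvature1r a : c a 1 = 0.
Proof. by rewrite /curvature s1 !mulr1 subrr. Qed.

Definition transfer (m : A \ox (A \ox A)) : E :=
  \tsum_(x *t w <- m) \tsum_(y *t z <- w) (c x y * s z).

Lemma transfer_linear : linear transfer.
Proof. by apply: tlift_linear; lin. Qed.
Let lt := transfer_linear.

Lemma transfer_pure x y z : transfer (x *t (y *t z)) = c x y * s z.
Proof. by rewrite /transfer !tlift_pure //; lin. Qed.

Lemma linear_ext3 (U : lmodType K) (f g : A \ox (A \ox A) -> U) :
  linear f -> linear g ->
  (forall x y z, f (x *t (y *t z)) = g (x *t (y *t z))) -> f =1 g.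
Proof.
move=> lf lg fg; apply: linear_ext => // x w.
by apply: (linear_ext (f := fun w => f (x *t w)) (g := fun w => g (x *t w)));
  [lin|lin|exact: fg].
Qed.

Definition double_curvature (a : A) (m : A \ox (A \ox A)) : E :=
  \tsum_(x *t w <- m) \tsum_(y *t z <- w) (c a x * c y z).

Definition bar_curvature (a : A) (w : A \ox A) : E :=
  \tsum_(x *t y <- w) (c a x * s y).

(** The Hochschild cocycle identity holds exactly, by associativity alone, although [s] is not
    multiplicative. *)
Lemma curvature_cocycle a x y :
  c (a * x) y = s a * c x y + c a (x * y) - c a x * s y.
Proof.
have zmod_id (P Q R S : E) : S - R = P - Q + (Q - R) - (P - S).
  by rewrite opprB [P - Q + _]addrA subrK [RHS]addrC addrA subrK.
by rewrite /curvature mulrBr mulrBl !mulrA; apply: zmod_id.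
Qed.

(* [A] acts on the kernel of [p] through [s] only up to [curvature s], which
   accounts for the last term. *)
Lemma transfer_lact a m :
  transfer (lact3 a m) =
  s a * transfer m - bar_curvature a (bar_diff m) - double_curvature a m.
Proof.
have bl3 := @lact3_bilin K A.
have lbar : linear (@bar_diff K A) by apply: tlift_linear; lin.
have lbc : linear (bar_curvature a) by apply: tlift_linear; lin.
have ldc : linear (double_curvature a) by apply: tlift_linear; lin.
apply: (linear_ext3 (f := fun m => transfer (lact3 a m)) (g := fun m => s a *
  transfer m - bar_curvature a (bar_diff m) - double_curvature a m));
    [lin|lin|].
move=> x y z; rewrite lact3_pure !transfer_pure.
have -> : bar_diff (x *t (y *t z)) = x *t (y * z) - (x * y) *t z.
  by rewrite /bar_diff tlift_pure; [rewrite tlift_pure //; lin|lin].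
have -> : double_curvature a (x *t (y *t z)) = c a x * c y z.
  by rewrite /double_curvature tlift_pure; [rewrite tlift_pure //; lin|lin].
rewrite (linD lbc) (linN lbc) /bar_curvature !tlift_pure; [|lin|lin].
have zmod_id (X Y Z W : E) : X + Y - Z = X - (W - Y) - (Z - W).
  by rewrite !opprB -!addrA addKr.
rewrite curvature_cocycle mulrBl mulrDl -!mulrA.
by rewrite [X in _ = _ - _ * X]/curvature mulrBr; apply: zmod_id.
Qed.

Lemma transfer_ract m b :
  transfer (ract3 m b) = transfer m * s b -
    \tsum_(x *t w <- m) \tsum_(y *t z <- w) (c x y * c z b).
Proof.
have br3 := @ract3_bilin K A.
apply: (linear_ext3 (f := fun m => transfer (ract3 m b)) (g := fun m =>
  transfer m * s b -
    \tsum_(x *t w <- m) \tsum_(y *t z <- w) (c x y * c z b))); [lin|lin|].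
move=> x y z; rewrite ract3_pure tract_pure !transfer_pure.
rewrite tlift_pure; last by lin.
rewrite tlift_pure; last by lin.
by rewrite -mulrA -mulrBr subKr.
Qed.

(** The correction is [transfer] applied to [T]. Its coboundary equals the curvature up to products
    of two curvatures, which lie one power deeper in the kernel. *)
Lemma newton_correction n (T : A -> A \ox (A \ox A)) :
  linear T ->
  (forall a b, T (a * b) = lact3 a (T b) + ract3 (T a) b) ->
  (forall a, bar_diff (T a) = (1 : A) *t a - a *t (1 : A)) ->
  (forall a b, kerpow p n (c a b)) ->
  exists2 u : A -> E, linear u &
    [/\ u 1 = 0, forall a, kerpow p n (u a) &
        forall a b, kerpow p n.+1 (defect s u a b)].
Proof.
move=> lT TM Td cn.
have T1 : T 1 = 0.
  by apply: (addrI (T 1)); rewrite addr0 -{3}[1]mulr1 TM lact31 ract31.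
exists (fun a => transfer (T a)); first by lin.
split=> [|a|a b]; first by rewrite T1 (lin0 lt).
  apply: tlift_pred => [|? ?|x w]; [exact: kerpow_zero|exact: kerpowD|].
  apply: tlift_pred => [|? ?|y z]; [exact: kerpow_zero|exact: kerpowD|].
  exact: kerpowMr.
have lbc : linear (bar_curvature a) by apply: tlift_linear; lin.
rewrite /defect TM (linD lt) transfer_lact transfer_ract Td (linD lbc) (linN
  lbc).
rewrite /bar_curvature !tlift_pure; [|lin|lin].
(* Unitality of [s] reduces the value on [1 *t b - b *t 1] to exactly [- c a b]. *)
rewrite curvature1r mul0r s1 mulr1 sub0r opprK.
set X := s a * _; set Y := transfer _ * _; set R := double_curvature _ _.
set R' := tlift _ _.
have -> : X + c a b - R + (Y - R') - X - Y - c a b = - R - R'.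
  rewrite addrA [X + _ - _ + _ + _](ACl (3*5*2*4*1)) /=.
  by rewrite !addrK.
(* In each remaining product the left curvature lies in the n-th power and the right one in the
   kernel. *)
apply: kerpowB; first apply: kerpowN; apply: tlift_pred => [|? ?|x w];
  rewrite ?kerpow_zero //; try exact: kerpowD; try exact: kerpow_zero;
  (apply: tlift_pred => [|? ?|y z]; [exact: kerpow_zero|exact: kerpowD|]);
  by apply: kerpowM => //; apply: curvature_ker.
Qed.

End Newton.

(** * Averaging the defect *)

Section AverageDefect.
Variables (K : fieldType) (C : kalg K) (D : C -> C \ox C) (e : C -> K).
Variable (beta : C -> C -> K).
Hypothesis hbeta : invariant_pairing D e beta.
Let bbeta : bilin (beta : C -> C -> K^o) := pairing_bilin hbeta.
Variables (A E : kalg K) (rhoA : A -> A \ox C) (rhoE : E -> E \ox C).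
Hypothesis hA : comodule_algebra D e rhoA.
Hypothesis hE : comodule_algebra D e rhoE.
Local Notation Av := (average beta rhoA rhoE).
Local Notation Av2 := (average2 beta rhoA rhoE).

Lemma average2B (B B' : A -> A -> E) a b :
  Av2 (fun a b => B a b - B' a b) a b = Av2 B a b - Av2 B' a b.
Proof.
have lE := coact_linear hE.
rewrite -tliftB; apply: eq_tlift => a0 g; rewrite -tliftB.
apply: eq_tlift => b0 h; rewrite (linD lE) (linN lE).
have lt : linear (fun x : E \ox C => \tsum_(w *t k <- x) (beta k (g * h) *: w)).
  by apply: tlift_linear; lin.
by rewrite (linD lt) (linN lt).
Qed.

(** Averaging is additive, acts on [u] alone in the products with the colinear [s], and fixes [s]
    itself; hence it also fixes the curvature term. *)
Lemma average_defect s u a b : linear s -> colinear rhoA rhoE s -> linear u ->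
  Av2 (defect s u) a b = defect s (Av u) a b.
Proof.
move=> ls cs lu.
rewrite [LHS](average2B (fun a b => u (a * b) - s a * u b - u a * s b)
  (curvature s)).
rewrite (average2B (fun a b => u (a * b) - s a * u b) (fun a b => u a * s b)).
rewrite (average2B (fun a b => u (a * b)) (fun a b => s a * u b)).
rewrite (average2B (fun a b => s a * s b) (fun a b => s (a * b))).
rewrite !(average2_mul hbeta hA hE) // !(average2_mull hbeta hA hE ls cs) //.
rewrite (average2_mulr hbeta hA hE ls cs lu).
by rewrite !(average_id hbeta hA ls cs).
Qed.

End AverageDefect.

(** * Lifting compatible with two commuting coactions *)

Section EquivariantLifting.
Variables (K : fieldType) (C1 C2 : kalg K).
Variables (D1 : C1 -> C1 \ox C1) (e1 : C1 -> K) (beta1 : C1 -> C1 -> K).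
Variables (D2 : C2 -> C2 \ox C2) (e2 : C2 -> K) (beta2 : C2 -> C2 -> K).
Hypothesis hbeta1 : invariant_pairing D1 e1 beta1.
Hypothesis hbeta2 : invariant_pairing D2 e2 beta2.
Variables (A E : kalg K).
Variables (rhoA1 : A -> A \ox C1) (rhoE1 : E -> E \ox C1).
Variables (rhoA2 : A -> A \ox C2) (rhoE2 : E -> E \ox C2).
Hypothesis hA1 : comodule_algebra D1 e1 rhoA1.
Hypothesis hE1 : comodule_algebra D1 e1 rhoE1.
Hypothesis hA2 : comodule_algebra D2 e2 rhoA2.
Hypothesis hE2 : comodule_algebra D2 e2 rhoE2.
Hypothesis hAC : coactions_commute rhoA2 rhoA1.
Hypothesis hEC : coactions_commute rhoE2 rhoE1.
Variable (p : E -> A).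
Hypotheses (lp : linear p) (pM : forall x y, p (x * y) = p x * p y).
Hypotheses (p1 : p 1 = 1).
Hypotheses (cp1 : colinear rhoE1 rhoA1 p) (cp2 : colinear rhoE2 rhoA2 p).

Let bicolinear (f : A -> E) :=
  colinear rhoA1 rhoE1 f /\ colinear rhoA2 rhoE2 f.

Local Notation Av1 := (average beta1 rhoA1 rhoE1).
Local Notation Av2 := (average beta2 rhoA2 rhoE2).

Lemma biaverage_linear f : linear f -> linear (Av2 (Av1 f)).
Proof.
move=> lf; apply: (average_linear hbeta2 hA2 hE2).
exact: (average_linear hbeta1 hA1 hE1).
Qed.

Lemma biaverage_bicolinear f : linear f -> bicolinear (Av2 (Av1 f)).
Proof.
move=> lf; have lf1 := average_linear hbeta1 hA1 hE1 lf.
split; last exact: (average_colinear hbeta2).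
apply: (average_colinear_comm hbeta2 hE2) => //.
- exact: coact_linear hA1.
- exact: coact_linear hE1.
- exact: (average_colinear hbeta1).
Qed.

(** For a linear section [s], the element [x = 1 - s 1] is nilpotent, so the geometric sum [u]
    inverts [s 1]. Right multiplication by [u] makes the section unital, and [p u = 1] keeps it a
    section. *)
Lemma unital_section : (forall a, exists x, p x = a) ->
  nilpotent_ideal (fun x : E => p x = 0) ->
  exists s : A -> E, [/\ linear s, s 1 = 1 & cancel s p].
Proof.
move=> psurj [n nil]; have [s ls sK] := linear_section lp psurj.
pose x := 1 - s 1; have px : p x = 0 by rewrite (linD lp) (linN lp) p1 sK subrr.
have xn : x ^+ n = 0 by rewrite -(nil (fun=> x)) // prodr_const card_ord.
pose u := \sum_(i < n) x ^+ i.
have s1u : s 1 * u = 1.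
  have -> : s 1 = 1 - x by rewrite opprB addrC subrK.
  by apply: oppr_inj; rewrite -mulNr opprB -subrX1 xn sub0r.
exists (fun a => s a * u); split=> [|//|a]; first by lin.
suff pu : p u = 1 by rewrite pM sK pu mulr1.
by rewrite -p1 -s1u pM sK mul1r.
Qed.

Lemma approximate_lifting : (forall a, exists x, p x = a) ->
  nilpotent_ideal (fun x : E => p x = 0) -> formally_smooth A ->
  forall n, exists s : A -> E, [/\ linear s, s 1 = 1, cancel s p, bicolinear s &
    forall a b, kerpow p n (curvature s a b)].
Proof.
move=> psurj pnil smooth; have [r [lr r1 rK]] := unital_section psurj pnil.
have [T [lT TM Td]] := smooth_derivation smooth.
have lAv1 f := @average_linear K C1 D1 e1 beta1 hbeta1 A E rhoA1 rhoE1 hA1 hE1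
  f.
(* The exponent starts at 1: the correction [v] then takes values in the kernel of [p], and [s + v]
   is again a section. *)
suff main n : exists s : A -> E, [/\ linear s, s 1 = 1, cancel s p,
    bicolinear s & forall a b, kerpow p n.+1 (curvature s a b)].
  by move=> n; have [s [? ? ? ? H]] := main n; exists s; split=> // a b;
    apply: kerpowS.
elim: n => [|n [s [ls s1 sK [cs1 cs2] sn]]].
  have lr1 := lAv1 _ lr.
  exists (Av2 (Av1 r)); split.
  - exact: biaverage_linear.
  - by apply: (average_unit1 hbeta2 hA2 hE2);
    last exact: (average_unit1 hbeta1 hA1 hE1).
  - apply: (average_section hbeta2 hA2) => //.
    exact: (average_section hbeta1 hA1).
  - exact: biaverage_bicolinear.
  move=> a b; apply: kerpow1; apply: curvature_ker => //.
  apply: (average_section hbeta2 hA2) => //.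
  exact: (average_section hbeta1 hA1).
have [u lu [u1 un ud]] := newton_correction lp pM ls s1 sK lT TM Td sn.
have lu1 := lAv1 _ lu.
pose v := Av2 (Av1 u).
have lv : linear v by exact: biaverage_linear.
have [cv1 cv2] : bicolinear v by exact: biaverage_bicolinear.
have v1 : v 1 = 0.
  by apply: (average_unit0 hbeta2 hA2 hE2) => //;
    apply: (average_unit0 hbeta1 hA1 hE1).
have vn a : kerpow p n.+1 (v a).
  apply: (average_kerpow hbeta2 hA2 hE2 lp cp2 lr rK) => //.
  exact: (average_kerpow hbeta1 hA1 hE1 lp cp1 lr rK).
have vd a b : kerpow p n.+2 (defect s v a b).
  (* The defect of the average is the average of the defect, first for the outer and then for the
     inner averaging. *)
  rewrite -(average_defect hbeta2 hA2 hE2) //.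
  apply: (average2_kerpow hbeta2 hA2 hE2 lp cp2 lr rK) => {}a {}b.
  rewrite -(average_defect hbeta1 hA1 hE1) //.
  exact: (average2_kerpow hbeta1 hA1 hE1 lp cp1 lr rK).
exists (fun a => s a + v a); split.
- by lin.
- by rewrite s1 v1 addr0.
- by move=> a; rewrite (linD lp) sK (kerpow_ker lp pM (vn a)) addr0.
- split=> a.
  + by rewrite (linD (coact_linear hE1)) cs1 cv1 -tliftD;
    apply: eq_tlift => x y;
      rewrite pureDl.
  + by rewrite (linD (coact_linear hE2)) cs2 cv2 -tliftD;
    apply: eq_tlift => x y;
      rewrite pureDl.
move=> a b.
(* The quadratic term [v a * v b] has one factor in the power n+1 and the other in the kernel, so it
   lies as deep as the defect. *)
have -> : curvature (fun a => s a + v a) a b = v a * v b - defect s v a b.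
  have zmod_id (X Y Z W S V : E) :
      X + Y + (Z + W) - (S + V) = W - (V - Y - Z - (X - S)).
    by rewrite !opprB opprD !addrA [LHS](ACl (4*1*5*3*2*6)).
  by rewrite /defect /curvature mulrDl !mulrDr; apply: zmod_id.
apply: kerpowB => //; apply: kerpowM => //.
exact: (kerpow_ker lp pM (vn b)).
Qed.

(** Take an exponent at which the power of the kernel vanishes; the curvature is then zero. *)
Theorem equivariant_lifting : (forall a, exists x, p x = a) ->
  nilpotent_ideal (fun x : E => p x = 0) -> formally_smooth A ->
  exists s : A -> E, [/\ linear s, GRing.monoid_morphism s, cancel s p,
    colinear rhoA1 rhoE1 s & colinear rhoA2 rhoE2 s].
Proof.
move=> psurj pnil smooth; have [n n0] := kerpow_nilpotent pnil.
have [s [ls s1 sK [cs1 cs2] sn]] := approximate_lifting psurj pnil smooth n.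
exists s; split=> //; split=> // a b.
by apply/esym/eqP; rewrite -subr_eq0; apply/eqP/n0/sn.
Qed.

End EquivariantLifting.

(** * Left coactions as right coactions of the co-opposite coalgebra *)

Section Bicomodules.
Variables (K : fieldType) (H : hopf K).

Lemma tswapK (V W : lmodType K) (x : V \ox W) : tswap (tswap x) = x.
Proof.
by rewrite [LHS]tlift_tswap ?tlift_purew //; lin.
Qed.

Lemma lcolinear_tswap (V W : lmodType K) (rhoV : V -> H \ox V)
    (rhoW : W -> H \ox W) (f : V -> W) : linear f ->
  lcolinear rhoV rhoW f <->
  colinear (fun v => tswap (rhoV v)) (fun w => tswap (rhoW w)) f.
Proof.
move=> lf; split=> cf v.
  rewrite cf tlift_tswap; last by lin.
  rewrite (linear_tlift _ _ (@tswap_linear _ _ _)); apply: eq_tlift => h v0.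
  by rewrite tswap_pure.
rewrite -[LHS]tswapK cf tlift_tswap; last by lin.
rewrite (linear_tlift _ _ (@tswap_linear _ _ _)); apply: eq_tlift => h v0.
by rewrite tswap_pure.
Qed.

Lemma tswap_tmul (A B : kalg K) (x y : A \ox B) :
  tswap (tmul x y) = tmul (tswap x) (tswap y).
Proof.
rewrite /tmul tlift_tswap; last by lin.
rewrite (linear_tlift _ _ (@tswap_linear _ _ _)); apply: eq_tlift => a b.
rewrite tlift_tswap; last by lin.
rewrite (linear_tlift _ _ (@tswap_linear _ _ _)); apply: eq_tlift => c d.
by rewrite tswap_pure.
Qed.

Lemma right_comodule_algebra (A : kalg K) (rho : {linear A -> A \ox H}) :
  is_rcomodule rho ->
  rcolinear (rcodiag rho rho) rho (@mul_tensor K A) ->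
  rcolinear (@rtriv K H) rho (@unit_map K A) ->
  comodule_algebra (Delta H) (counit H) rho.
Proof.
move=> [rA re] rM r1; split=> // [|a b|]; first exact: linearP.
- rewrite -mul_tensor_pure rM /rcodiag tlift_pure; last by lin.
  rewrite tlift_tlift; last by lin.
  apply: eq_tlift => a0 g; rewrite tlift_tlift; last by lin.
  apply: eq_tlift => b0 h; rewrite tlift_pure ?mul_tensor_pure //; lin.
- have := r1 (1 : K^o); rewrite /rtriv /unit_map tlift_pure; last by lin.
  by rewrite scale1r.
Qed.

Lemma left_comodule_algebra (A : kalg K) (rho : {linear A -> H \ox A}) :
  is_lcomodule rho ->
  lcolinear (lcodiag rho rho) rho (@mul_tensor K A) ->
  lcolinear (@ltriv K H) rho (@unit_map K A) ->
  comodule_algebra (fun x => tswap (Delta H x)) (counit H)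
    (fun a => tswap (rho a)).
Proof.
move=> [rA re] rM r1; split=> [|v|a|a b|]; first by lin.
- have tF : trilin (fun (x y : H) (a : A) => a *t (y *t x)) by lin.
  rewrite !tlift_tswap; [|lin|lin].
  transitivity (\tsum_(h *t v0 <- rho v) \tsum_(v01 *t v00 <- rho v0)
    (v00 *t (v01 *t h))).
    by apply: eq_tlift => h v0; rewrite tlift_tswap //; lin.
  rewrite (tsum2_trilin tF (rA v)).
  by apply: eq_tlift => h v0; rewrite tlift_tswap //; lin.
- by rewrite tlift_tswap ?re //; lin.
- rewrite -tswap_tmul; congr tswap.
  rewrite -mul_tensor_pure rM /lcodiag tlift_pure; last by lin.
  rewrite tlift_tlift; last by lin.
  apply: eq_tlift => a0 g; rewrite tlift_tlift; last by lin.
  apply: eq_tlift => b0 h; rewrite tlift_pure ?mul_tensor_pure //; lin.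
- have := r1 (1 : K^o); rewrite /ltriv /unit_map tlift_pure; last by lin.
  by rewrite scale1r => ->; rewrite tswap_pure.
Qed.

Lemma bicomodule_commute (V : lmodType K) (rhol : {linear V -> H \ox V})
    (rhor : {linear V -> V \ox H}) : is_bicomodule rhol rhor ->
  coactions_commute (fun v => tswap (rhol v)) rhor.
Proof.
case=> _ _ rC v.
have tF : trilin (fun (x : H) (v : V) (y : H) => v *t (x *t y)) by lin.
rewrite tlift_tswap; last by lin.
rewrite (tsum2_trilin tF (rC v)).
by apply: eq_tlift => v0 g; rewrite tlift_tswap //; lin.
Qed.

End Bicomodules.

Theorem bicomodule_lifting (K : fieldType) (H : hopf K) (lam : {scalar H}) :
  ad_invariant_integral lam ->
  forall (A E : bicomod_alg H) (pi : {linear E -> A}),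
  bicomod_alg_hom pi ->
  (forall a : A, exists e : E, pi e = a) ->
  formally_smooth A ->
  nilpotent_ideal (fun e : E => pi e = 0) ->
  exists sigma : {linear A -> E}, bicomod_alg_hom sigma /\ cancel sigma pi.
Proof.
move=> hlam A E pi [[pi1 piM] lpi rpi] surj smooth nil.
have rA (B : bicomod_alg H) : comodule_algebra (Delta H) (counit H) (bca_rcoact
  B).
  apply: right_comodule_algebra; [|exact: bca_rmul|exact: bca_runit].
  by case: (bca_bicomodule B).
have lA (B : bicomod_alg H) : comodule_algebra (fun x => tswap (Delta H x))
    (counit H) (fun b => tswap (bca_lcoact B b)).
  apply: left_comodule_algebra; [|exact: bca_lmul|exact: bca_lunit].
  by case: (bca_bicomodule B).
have comm (B : bicomod_alg H) := bicomodule_commute (bca_bicomodule B).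
have lp : linear pi by exact: linearP.
(* The right coaction is the first one and the flipped left coaction the second. *)
have [s [ls sM sK rs' ls']] := equivariant_lifting (right_pairing hlam)
  (left_pairing hlam) (rA A) (rA E) (lA A) (lA E) (comm A) (comm E)
  lp piM pi1 rpi ((lcolinear_tswap _ _ lp).1 lpi) surj nil smooth.
pose sL : {linear A -> E} := HB.pack s (GRing.isLinear.Build K A E *:%R s ls).
exists sL; split=> //; split=> //.
exact/(lcolinear_tswap _ _ ls).
Qed.

(** * Right comodule algebras as bicomodule algebras *)

Section TrivialCoaction.
Variables (K : fieldType) (H : hopf K) (A : rcomod_alg H).

Definition trivial_lcoact (a : A) : H \ox A := (1 : H) *t a.

Lemma trivial_lcoact_is_linear : linear trivial_lcoact.
Proof. by rewrite /trivial_lcoact; lin. Qed.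
HB.instance Definition _ := GRing.isLinear.Build K A (H \ox A) *:%R
  trivial_lcoact trivial_lcoact_is_linear.

Lemma trivial_lcoact_bicomodule :
  is_bicomodule (trivial_lcoact : {linear A -> H \ox A}) (rca_coact A).
Proof.
have [rA re] := rca_comodule A; split; [split=> v|by []|move=> v];
  rewrite /= /trivial_lcoact.
- rewrite tlift_pure; last by lin.
  rewrite tlift_pure; last by lin.
  rewrite tlift_pure; last by lin.
  by rewrite hopf_Delta1 tlift_pure //; lin.
- rewrite tlift_pure; last by lin.
  by rewrite hopf_counit1 scale1r.
- rewrite tlift_pure; last by lin.
  by apply: eq_tlift => v0 g; rewrite tlift_pure //; lin.
Qed.

Lemma trivial_lcoact_mul : lcolinear
  (lcodiag (trivial_lcoact : {linear A -> H \ox A})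
           (trivial_lcoact : {linear A -> H \ox A}))
  (trivial_lcoact : {linear A -> H \ox A}) (@mul_tensor K A).
Proof.
move=> x; rewrite /lcodiag tlift_tlift; last by lin.
rewrite /= /trivial_lcoact -{1}[x]tlift_purew.
rewrite (linear_tlift (g := fun x => (1 : H) *t mul_tensor x)); last by lin.
apply: eq_tlift => a b; rewrite tlift_pure; last by lin.
by rewrite tlift_pure; [rewrite tlift_pure ?mulr1 //; lin|lin].
Qed.

Lemma trivial_lcoact_unit : lcolinear (@ltriv K H)
  (trivial_lcoact : {linear A -> H \ox A}) (@unit_map K A).
Proof.
move=> k; rewrite /ltriv tlift_pure //.
by rewrite /unit_map; lin.
Qed.

Definition bicomod_of_rcomod : bicomod_alg H :=
  BicomodAlg trivial_lcoact_bicomodule trivial_lcoact_mul (@rca_mul _ _ A)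
    trivial_lcoact_unit (@rca_unit _ _ A).

End TrivialCoaction.

Theorem theorem4p7 (K : fieldType) (H : hopf K) (lam : {scalar H})
    (hlam : ad_invariant_integral lam) :
  (forall (A E : rcomod_alg H) (pi : {linear E -> A}),
     rcomod_alg_hom pi ->
     (forall a : A, exists e : E, pi e = a) ->
     formally_smooth A ->
     nilpotent_ideal (fun e : E => pi e = 0) ->
     exists sigma : {linear A -> E}, rcomod_alg_hom sigma /\ cancel sigma pi)
  /\
  (forall (A E : bicomod_alg H) (pi : {linear E -> A}),
     bicomod_alg_hom pi ->
     (forall a : A, exists e : E, pi e = a) ->
     formally_smooth A ->
     nilpotent_ideal (fun e : E => pi e = 0) ->
     exists sigma : {linear A -> E}, bicomod_alg_hom sigma /\ cancel sigma pi).
Proof.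
split; last exact: (bicomodule_lifting hlam).
move=> A E pi [piM rpi] surj smooth nil.
have [|sigma [[sM _ rs] sK]] := bicomodule_lifting hlam
  (A := bicomod_of_rcomod A) (E := bicomod_of_rcomod E) (pi := pi) _ surj
    smooth nil.
  (* Any linear map is colinear for the trivial left coactions. *)
  split=> // x; rewrite /= /trivial_lcoact tlift_pure //; lin.
by exists sigma.
Qed.
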